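(* In the two-group Gaussian DAG model with priors described in the context, for each group $k\in\{1,2\}$ and each node $j\in\{2,\dots,q\}$, the conditional posterior distribution of the coefficient vector of node $j$ is $$\boldsymbol{L}_j^{(k)}\mid\sigma_j^2,\boldsymbol{X}^{(k)},\mathcal{D}^{(k)}\ \sim\ \mathcal{N}_{|\mathrm{pa}^{(k)}(j)|}\left(-\hat{\boldsymbol{L}}_j^{(k)},\ \sigma_j^2\big(\bar{\boldsymbol{T}}_j^{(k)}\big)^{-1}\right),$$ and for node $1$ (where $\sigma_1^2=1$), $$\boldsymbol{L}_1^{(k)}\mid\boldsymbol{X}^{(k)},\mathcal{D}^{(k)}\ \sim\ \mathcal{N}_{|\mathrm{pa}^{(k)}(1)|}\left(-\hat{\boldsymbol{L}}_1^{(k)},\ \big(\bar{\boldsymbol{T}}_1^{(k)}\big)^{-1}\right),$$ where $\bar{\boldsymbol{T}}_j^{(k)}=g_k\boldsymbol{I}_{|\mathrm{pa}^{(k)}(j)|}+\boldsymbol{X}^{(k)\prime}_{\mathrm{pa}(j)}\boldsymbol{X}^{(k)}_{\mathrm{pa}(j)}$ and $\hat{\boldsymbol{L}}_j^{(k)}=\big(\bar{\boldsymbol{T}}_j^{(k)}\big)^{-1}\boldsymbol{X}^{(k)\prime}_{\mathrm{pa}(j)}\boldsymbol{X}_j^{(k)}$.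
   Context: For $k=1,2$: $\mathcal{D}^{(k)}$ is a given DAG on $V=\{1,\dots,q\}$, $\mathrm{pa}^{(k)}(j)$ is the parent set of $j$ in $\mathcal{D}^{(k)}$, $\boldsymbol{X}^{(k)}$ is a real $n_k\times q$ matrix with columns $\boldsymbol{X}^{(k)}_1,\dots,\boldsymbol{X}^{(k)}_q$, and $\boldsymbol{X}^{(k)}_{\mathrm{pa}(j)}$ is the submatrix of columns indexed by $\mathrm{pa}^{(k)}(j)$. A prime denotes transpose. Parameters: $\sigma_1^2=1$ fixed; $\sigma_j^2>0$ for $j\ge2$, shared by both groups; and $\boldsymbol{L}_j^{(k)}\in\mathbb{R}^{|\mathrm{pa}^{(k)}(j)|}$. Likelihood: $$f(\boldsymbol{X}^{(1)},\boldsymbol{X}^{(2)}\mid\sigma^2,\boldsymbol{L}^{(1)},\boldsymbol{L}^{(2)})=\prod_{k=1}^2\prod_{j=1}^q f_{\mathcal{N}_{n_k}}\big(\boldsymbol{X}_j^{(k)}\mid-\boldsymbol{X}^{(k)}_{\mathrm{pa}(j)}\boldsymbol{L}_j^{(k)},\ \sigma_j^2\boldsymbol{I}_{n_k}\big),$$ with $f_{\mathcal{N}_n}(\cdot\mid\boldsymbol\mu,\boldsymbol\Sigma)$ the $n$-variate normal density. Priors (independent over $j$; given $\sigma_j^2$, independent over $k$), with hyperparameters $g_1,g_2>0$, $a>q-1$: for $j\ge2$, $\sigma_j^2\sim\mathrm{I\text{-}Ga}\big(\tfrac{a_j^{(1)}+a_j^{(2)}}{2},\tfrac{g_1+g_2}{2}\big)$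 (inverse gamma with shape and rate parameters), where $a_j^{(k)}=a+|\mathrm{pa}^{(k)}(j)|-q+1$; and for all $j$, $\boldsymbol{L}_j^{(k)}\mid\sigma_j^2\sim\mathcal{N}_{|\mathrm{pa}^{(k)}(j)|}\big(\boldsymbol0,\ g_k^{-1}\sigma_j^2\boldsymbol{I}\big)$. *)

(* Defs.v *)
From HB Require Import structures.
From mathcomp Require Import all_boot all_order all_algebra.
From mathcomp Require Import all_classical all_reals all_analysis.
From mathcomp Require Import measurable_realfun.

Set Implicit Arguments.
Unset Strict Implicit.
Unset Printing Implicit Defensive.

Import Order.TTheory GRing.Theory Num.Theory.
Import numFieldNormedType.Exports.

Local Open Scope classical_set_scope.
Local Open Scope ring_scope.

(* Matrices carry the product sigma-algebra: the one generated by the entries. *)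
Definition measure_mx_display : measure_display -> measure_display.
Proof. exact. Qed.

Section measurable_matrix.
Context {d : measure_display} {T : measurableType d}.
Variables m n : nat.

Definition mx_measurable : set (set 'M[T]_(m, n)) :=
  <<s \bigcup_(ij in [set: 'I_m * 'I_n])
        preimage_set_system setT (fun M : 'M[T]_(m, n) => M ij.1 ij.2)
          measurable >>.

Let mx_measurable0 : mx_measurable set0.
Proof. exact: sigma_algebra0. Qed.

Let mx_measurableC A : mx_measurable A -> mx_measurable (~` A).
Proof. exact: sigma_algebraC. Qed.

Let mx_measurable_bigcup (F : (set 'M[T]_(m, n))^nat) :
  (forall i, mx_measurable (F i)) -> mx_measurable (\bigcup_i (F i)).
Proof. exact: sigma_algebra_bigcup. Qed.

HB.instance Definition _ := @isMeasurable.Build (measure_mx_display d)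
  'M[T]_(m, n) mx_measurable mx_measurable0 mx_measurableC mx_measurable_bigcup.

End measurable_matrix.

Section integrals.
Variable R : realType.

(* Given one integral functional per coordinate, integrate F over the
   coordinates listed in s, the other coordinates being frozen at their value
   in v.  For a nonnegative measurable F and duplicate-free s this is, by
   Tonelli, the integral against the product measure, whatever the order. *)
Fixpoint iter_int (I : eqType) (T : I -> Type)
    (int : forall i, (T i -> \bar R) -> \bar R) (s : seq I)
    (F : (forall i, T i) -> \bar R) (v : forall i, T i) : \bar R :=
  match s with
  | [::] => F v
  | i :: s' => int i (fun x : T i => iter_int int s' F (@dfwith I T v i x))
  end.

Definition real_int (F : R -> \bar R) : \bar R :=
  (\int[@lebesgue_measure R]_x F x)%E.

(* Integral with respect to Lebesgue measure on R^(m x n). *)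
Definition mx_int (m n : nat) (F : 'M[R]_(m, n) -> \bar R) : \bar R :=
  iter_int (fun _ : 'I_m * 'I_n => real_int) (enum {: 'I_m * 'I_n})
    (fun v => F (\matrix_(i, j) v (i, j))) (fun=> 0).

End integrals.

Section distributions.
Variable R : realType.

Definition Gamma (s : R) : R :=
  Rintegral (@lebesgue_measure R) `]0, +oo[
    (fun t => t `^ (s - 1) * expR (- t)).

(* Shape alpha, rate beta. *)
Definition invgamma_pdf (alpha beta x : R) : R :=
  if 0 < x then
    beta `^ alpha / Gamma alpha * x `^ (- alpha - 1) * expR (- beta / x)
  else 0.

Definition mvnormal_pdf (n : nat) (m : 'cV[R]_n) (S : 'M[R]_n) (x : 'cV[R]_n)
    : R :=
  (Num.sqrt ((2 * pi) ^+ n * \det S))^-1 *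
  expR (- (((x - m)^T *m invmx S *m (x - m)) 0 0 / 2)).

Definition mvnormal (n : nat) (m : 'cV[R]_n) (S : 'M[R]_n)
    (A : set 'cV[R]_n) : \bar R :=
  mx_int (fun x => (mvnormal_pdf m S x * \1_A x)%:E).

(* kappa is a regular version of the conditional distribution of Y given Z.
   Being a probability measure is only required almost surely: a kernel such as
   z |-> N(m(z), S(z)) is meaningful only where S(z) is positive definite. *)
Definition conditional_distribution (d d1 d2 : measure_display)
    (Omega : measurableType d) (P : probability Omega R)
    (T1 : measurableType d1) (T2 : measurableType d2)
    (Y : Omega -> T1) (Z : Omega -> T2) (kappa : T2 -> set T1 -> \bar R)
    : Prop :=
  [/\ forall A, measurable A -> measurable_fun setT (fun z => kappa z A),
      {ae P, forall w, exists Q : probability T1 R,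
         forall A, measurable A -> kappa (Z w) A = Q A}
    & forall A B, measurable A -> measurable B ->
        P (Y @^-1` A `&` Z @^-1` B) =
        (\int[P]_(w in Z @^-1` B) kappa (Z w) A)%E].

End distributions.

Section dag.
Variable q : nat.
Implicit Type D : rel 'I_q.

(* D i j is the edge i -> j. *)
Definition is_dag D : Prop := forall c : seq 'I_q, cycle D c -> c = [::].

Definition pa D (j : 'I_q) : {set 'I_q} := [set i | D i j].

Definition pa_cols (R : Type) D (n : nat) (X : 'M[R]_(n, q)) (j : 'I_q)
    : 'M[R]_(n, #|pa D j|) :=
  colsub (fun l : 'I_#|pa D j| => enum_val l) X.

End dag.

Section model.
Variables (R : realType) (q : nat).
(* The two groups are indexed by 'I_2; node 1 is the index with value 0. *)
Variables (D : 'I_2 -> rel 'I_q) (n : 'I_2 -> nat) (g : 'I_2 -> R) (a : R).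

Definition coefs : Type := forall (k : 'I_2) (j : 'I_q), 'cV[R]_#|pa (D k) j|.
Definition data : Type := forall k : 'I_2, 'M[R]_(n k, q).
Definition state : Type := (('I_q -> R) * coefs * data)%type.

Definition acoef (k : 'I_2) (j : 'I_q) : R := a + #|pa (D k) j|%:R - q%:R + 1.

Definition likelihood (s : 'I_q -> R) (L : coefs) (X : data) : R :=
  \prod_(k < 2) \prod_(j < q)
    mvnormal_pdf (- (pa_cols (D k) (X k) j *m L k j)) (s j)%:M (col j (X k)).

Definition sigma_prior (s : 'I_q -> R) : R :=
  \prod_(j < q | val j != 0%N)
    invgamma_pdf ((\sum_(k < 2) acoef k j) / 2) ((\sum_(k < 2) g k) / 2) (s j).

Definition coef_prior (s : 'I_q -> R) (L : coefs) : R :=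
  \prod_(j < q) \prod_(k < 2) mvnormal_pdf 0 ((g k)^-1 * s j)%:M (L k j).

Definition joint_pdf (s : 'I_q -> R) (L : coefs) (X : data) : R :=
  sigma_prior s * coef_prior s L * likelihood s L X.

(* Integral over all the unknowns except the variance of node 1, which is
   frozen at 1: Lebesgue measure on the others. *)
Definition state_int (F : state -> \bar R) : \bar R :=
  iter_int (fun _ : 'I_q => @real_int R) [seq j : 'I_q <- enum 'I_q | val j != 0%N]
    (fun s =>
  iter_int (fun p : 'I_2 * 'I_q => @mx_int R #|pa (D p.1) p.2| 1)
    (enum {: 'I_2 * 'I_q})
    (fun l =>
  iter_int (fun k : 'I_2 => @mx_int R (n k) q) (enum 'I_2)
    (fun X => F (s, (fun k j => l (k, j)), X))
    (fun=> 0))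
    (fun=> 0))
    (fun=> 1).

Definition box (S : 'I_q -> set R)
    (A : forall k j, set 'cV[R]_#|pa (D k) j|)
    (C : forall k, set 'M[R]_(n k, q)) : set state :=
  [set t | [/\ forall j, S j (t.1.1 j), forall k j, A k j (t.1.2 k j)
             & forall k, C k (t.2 k)]].

Definition state_measurable : set (set state) :=
  <<s [set E | exists S A C,
        [/\ forall j, measurable (S j), forall k j, measurable (A k j),
            forall k, measurable (C k) & E = box S A C]] >>.

(* The parameters and the data are jointly distributed with density
   prior * likelihood. *)
Definition two_group_model (d : measure_display) (Omega : measurableType d)
    (P : probability Omega R) (sigma2 : 'I_q -> {RV P >-> R})
    (L : forall k j, {RV P >-> 'cV[R]_#|pa (D k) j|})
    (X : forall k, {RV P >-> 'M[R]_(n k, q)}) : Prop :=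
  forall E, state_measurable E ->
    P [set w | E (fun j => sigma2 j w, fun k j => L k j w, fun k => X k w)] =
    state_int (fun t => (joint_pdf t.1.1 t.1.2 t.2 * \1_E t)%:E).

Definition Tbar (k : 'I_2) (j : 'I_q) (X : 'M[R]_(n k, q))
    : 'M[R]_#|pa (D k) j| :=
  (g k)%:M + (pa_cols (D k) X j)^T *m pa_cols (D k) X j.

Definition Lhat (k : 'I_2) (j : 'I_q) (X : 'M[R]_(n k, q))
    : 'cV[R]_#|pa (D k) j| :=
  invmx (Tbar j X) *m (pa_cols (D k) X j)^T *m col j X.

End model.

(* Main.v *)
From HB Require Import structures.
Require Import Defs.
From mathcomp Require Import all_boot all_order all_algebra.
From mathcomp Require Import all_classical all_reals all_analysis.
From mathcomp Require Import measurable_realfun.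
From mathcomp Require Import ring.

Set Implicit Arguments.
Unset Strict Implicit.
Unset Printing Implicit Defensive.

Import Order.TTheory GRing.Theory Num.Theory.
Import numFieldNormedType.Exports.

Local Open Scope classical_set_scope.
Local Open Scope ring_scope.

(* The joint density, as a function of the single vector L_j^(k), is a constant
   times the product of its prior and of the likelihood of X_j^(k).  Completing
   the square turns this product into K * N(-Lhat, sigma_j^2 Tbar^-1), with K
   free of L_j^(k); so replacing the indicator of {L_j^(k) in A} by the
   normal probability of A does not change the integral over L_j^(k), and
   Tonelli's theorem lets this integral be taken first.

   That the normal density has mass one is proved by induction on the
   dimension: integrating out all coordinates but the first leaves a
   one-dimensional Gaussian whose precision is a Schur complement.

   The iterated integrals are not given by product measures; they are handled
   through the predicate [tonelli], which is stable under iteration and implies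
   homogeneity, countable additivity and, by the layer-cake formula, the change
   of variables under the joint law. *)

(* The library only registers the counting measure as a sigma-finite content. *)
HB.instance Definition _ (R : realType) :=
  @Measure_isSigmaFinite.Build _ nat R counting (sigma_finite_counting R).

(** * Functionals satisfying Tonelli's theorem *)

Section tonelli.
Variable R : realType.

(** No measure is attached to [J]. Letting the parameter space [Z] be arbitrary is what makes the
    property stable under iteration: the remaining coordinates can themselves be put into [Z]. *)
Definition tonelli d (T : measurableType d) (J : (T -> \bar R) -> \bar R) :=
  forall d' (Z : measurableType d') (F : Z * T -> \bar R),
    measurable_fun setT F -> (forall x, 0 <= F x)%E ->
    [/\ measurable_fun setT (fun z => J (fun x => F (z, x))),
        forall z, (0 <= J (fun x => F (z, x)))%E
      & forall mu : {sigma_finite_measure set Z -> \bar R},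
        J (fun x => \int[mu]_z F (z, x))%E =
        (\int[mu]_z J (fun x => F (z, x)))%E].

Lemma tonelli_real_int : tonelli (@real_int R).
Proof.
move=> d Z F mF F0; split.
- exact: (measurable_fun_fubini_tonelli_F (m2 := @lebesgue_measure R)).
- by move=> z; apply: integral_ge0.
- by move=> mu; rewrite /real_int -fubini_tonelli.
Qed.

Section basics.
Context d (T : measurableType d) (J : (T -> \bar R) -> \bar R).
Hypothesis tJ : tonelli J.

(** Multiplication by [c] is integration against [c] times the Dirac mass on a one-point space, so
    this is an instance of the swap. *)
Lemma tonelliZl (c : R) (F : T -> \bar R) :
  (0 <= c)%R -> measurable_fun setT F -> (forall x, 0 <= F x)%E ->
  J (fun x => c%:E * F x)%E = (c%:E * J F)%E.
Proof.
move=> c0 mF F0; have mF' : measurable_fun [set: unit * T] (F \o snd).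
  exact: measurableT_comp.
have [_ J0 S] := tJ mF' (fun x => F0 x.2).
have intE e : (0 <= e)%E ->
    (\int[mscale (NngNum c0) (\d_ tt)]_(z in setT) e = c%:E * e)%E.
  by move=> e0; rewrite ge0_integral_mscale//= integral_dirac//= diracT mul1e.
have := S (mscale (NngNum c0) (\d_ tt)) => /=.
by under eq_fun do rewrite intE//; rewrite intE//; exact: (J0 tt).
Qed.

Lemma tonelli0 : J (fun=> 0%E) = 0%E.
Proof.
have := @tonelliZl 0 (fun=> 0%E) (lexx _) (measurable_cst _) (fun=> lexx _).
by under eq_fun do rewrite mule0; rewrite mul0e.
Qed.

(** A series is an integral against the counting measure on [nat], which is sigma-finite. *)
Lemma tonelli_nneseries (F : nat -> T -> \bar R) :
  (forall i, measurable_fun setT (F i)) -> (forall i x, 0 <= F i x)%E ->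
  J (fun x => \sum_(i <oo) F i x)%E = (\sum_(i <oo) J (F i))%E.
Proof.
move=> mF F0.
have mF' : measurable_fun [set: nat * T] (fun p => F p.1 p.2).
  move=> _ Y mY; rewrite setTI.
  (* The preimage is cut into countably many slices, one for each index. *)
  have -> : (fun p : nat * T => F p.1 p.2) @^-1` Y =
      \bigcup_i ([set i] `*` (F i @^-1` Y)).
    apply/seteqP; split=> [[i x] /= Yx|[i x] [j _ [/= -> //]]].
    by exists i.
  apply: bigcup_measurable => i _; apply: measurableX => //.
  by rewrite -[X in measurable X]setTI; exact: mF.
have [_ J0 S] := tJ mF' (fun x => F0 x.1 x.2).
have := S counting.
under eq_fun do rewrite ge0_integral_count//=.
by rewrite ge0_integral_count.
Qed.

Lemma tonelli_comp d' (U : measurableType d') (f : T -> U) :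
  measurable_fun setT f -> tonelli (fun F => J (F \o f)).
Proof.
move=> mf d1 Z F mF F0.
have mG : measurable_fun [set: Z * T] (fun p => F (p.1, f p.2)).
  apply: (measurableT_comp mF); apply: measurable_fun_pair => //.
  exact: measurableT_comp.
exact: (tJ mG (fun p => F0 _)).
Qed.

End basics.

Lemma tonelli_pair d1 (T1 : measurableType d1) d2 (T2 : measurableType d2)
    (J1 : (T1 -> \bar R) -> \bar R) (J2 : (T2 -> \bar R) -> \bar R) :
  tonelli J1 -> tonelli J2 ->
  tonelli (fun F : T1 * T2 -> \bar R => J1 (fun x => J2 (fun y => F (x, y)))).
Proof.
move=> t1 t2 d Z F mF F0.
have mG : measurable_fun [set: (Z * T1) * T2]
    (fun p => F (p.1.1, (p.1.2, p.2))).
  apply: (measurableT_comp mF); repeat apply: measurable_fun_pair => //;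
    exact: measurableT_comp.
have [mJ2 J20 _] := t2 _ _ _ mG (fun=> F0 _).
have [mJ1 J10 S1] := t1 _ _ _ mJ2 J20.
split => // mu; rewrite -S1; congr J1; apply/funext => x.
have mGx : measurable_fun [set: Z * T2] (fun p => F (p.1, (x, p.2))).
  by apply: (measurableT_comp mF); repeat apply: measurable_fun_pair.
by have [_ _ ->] := t2 _ _ _ mGx (fun=> F0 _).
Qed.

(** [tonelli] only swaps [J] with integrals against genuine measures; swapping two iterated
    integrals needs this relation between two abstract functionals. *)
Definition commuting d1 (T1 : measurableType d1) d2 (T2 : measurableType d2)
    (J1 : (T1 -> \bar R) -> \bar R) (J2 : (T2 -> \bar R) -> \bar R) :=
  forall F : T1 * T2 -> \bar R,
    measurable_fun setT F -> (forall x, 0 <= F x)%E ->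
    J1 (fun x => J2 (fun y => F (x, y))) = J2 (fun y => J1 (fun x => F (x, y))).

Lemma commuting_comp d1 (T1 : measurableType d1) d2 (T2 : measurableType d2)
    d3 (T3 : measurableType d3) (f : T2 -> T3)
    (J1 : (T1 -> \bar R) -> \bar R) (J2 : (T2 -> \bar R) -> \bar R) :
  measurable_fun setT f -> commuting J1 J2 ->
  commuting J1 (fun F => J2 (F \o f)).
Proof.
move=> mf c12 F mF F0; apply: (c12 (fun p => F (p.1, f p.2))) => //.
apply: (measurableT_comp mF); apply: measurable_fun_pair => //.
exact: measurableT_comp.
Qed.

Lemma commuting_real_int d (T : measurableType d)
  (J : (T -> \bar R) -> \bar R) : tonelli J -> commuting J (@real_int R).
Proof.
move=> tJ F mF F0.
have mF' : measurable_fun [set: R * T] (fun p => F (p.2, p.1)).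
  by apply: (measurableT_comp mF); exact: measurable_fun_pair.
have [_ _ S] := tJ _ (measurableTypeR R) _ mF' (fun=> F0 _).
exact: (S (@lebesgue_measure R)).
Qed.

End tonelli.

(** * Dependent products with the sigma-algebra generated by the coordinates *)

Definition pi_display : measure_display -> measure_display.
Proof. exact. Qed.

Section pi_type.
Context (I : eqType) (d : measure_display) (T : I -> measurableType d).

(** A named copy of the dependent product, to which the structure of measurable space can be
    attached. *)
Definition pi_type := forall i, T i.

HB.instance Definition _ := gen_eqMixin pi_type.
HB.instance Definition _ := gen_choiceMixin pi_type.
HB.instance Definition _ := isPointed.Build pi_type (fun i => point).

Definition pi_gen : set (set pi_type) :=
  \bigcup_i preimage_set_system setT (fun v : pi_type => v i) measurable.

Let pi_measurable0 : <<s pi_gen >> set0.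
Proof. exact: sigma_algebra0. Qed.

Let pi_measurableC A : <<s pi_gen >> A -> <<s pi_gen >> (~` A).
Proof. exact: sigma_algebraC. Qed.

Let pi_measurable_bigcup (F : (set pi_type)^nat) :
  (forall i, <<s pi_gen >> (F i)) -> <<s pi_gen >> (\bigcup_i (F i)).
Proof. exact: sigma_algebra_bigcup. Qed.

HB.instance Definition _ := @isMeasurable.Build (pi_display d)
  pi_type <<s pi_gen >> pi_measurable0 pi_measurableC pi_measurable_bigcup.

Lemma measurable_proj_pi i : measurable_fun setT (fun v : pi_type => v i).
Proof.
move=> _ A mA; apply: sub_sigma_algebra; exists i => //.
by exists A.
Qed.

Lemma measurable_fun_pi d' (Z : measurableType d') (f : Z -> pi_type) :
  (forall i, measurable_fun setT (fun z => f z i)) -> measurable_fun setT f.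
Proof.
move=> mf; apply: (measurability pi_gen) => //.
move=> _ [_ [i _ [A mA <-]] <-]; rewrite !setTI -comp_preimage.
by rewrite -[X in measurable X]setTI; exact: mf.
Qed.

Lemma measurable_dfwith i :
  measurable_fun setT (fun p : pi_type * T i => dfwith p.1 i p.2 : pi_type).
Proof.
apply: measurable_fun_pi => j; have [<-|ij] := eqVneq i j.
  by under eq_fun do rewrite dfwithin; exact: measurable_snd.
under eq_fun do rewrite dfwithout//.
exact: (measurableT_comp (measurable_proj_pi (i := j)) measurable_fst).
Qed.

End pi_type.

(** * Iterated integrals over families of coordinates *)

Section iter_int.
Context (R : realType) (I : eqType) (d : measure_display).
Context (T : I -> measurableType d).
Variable int : forall i, (T i -> \bar R) -> \bar R.
Arguments int : clear implicits.
Hypothesis tint : forall i, tonelli (int i).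

(** The base point varies together with [z]: each integration evaluates the inner integral at an
    updated base point, so the induction needs joint measurability in both. *)
Lemma iter_int_tonelli_aux s d' (Z : measurableType d')
    (F : Z * pi_type T -> \bar R) :
  measurable_fun setT F -> (forall x, 0 <= F x)%E ->
  [/\ measurable_fun setT
        (fun p : Z * pi_type T => iter_int int s (fun w => F (p.1, w)) p.2),
      forall z v, (0 <= iter_int int s (fun w => F (z, w)) v)%E
    & forall (mu : {sigma_finite_measure set Z -> \bar R}) v,
        iter_int int s (fun w => \int[mu]_z F (z, w))%E v =
        (\int[mu]_z iter_int int s (fun w => F (z, w)) v)%E].
Proof.
move=> mF F0; elim: s => [|i s [mI I0 IS]] /=.
  by split => //; under eq_fun do rewrite -surjective_pairing.
have mG : measurable_fun [set: (Z * pi_type T) * T i]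
    (fun p => iter_int int s (fun w => F (p.1.1, w)) (dfwith p.1.2 i p.2)).
  apply: (measurableT_comp mI (g := fun p : (Z * pi_type T) * T i =>
    (p.1.1, dfwith p.1.2 i p.2 : pi_type T))).
  apply: measurable_fun_pair; first exact: measurableT_comp.
  apply: (measurableT_comp (measurable_dfwith (i := i))
    (g := fun p : (Z * pi_type T) * T i => (p.1.2, p.2))).
  by apply: measurable_fun_pair => //; exact: measurableT_comp.
have [mJ J0 _] := tint mG (fun=> I0 _ _).
split => // [z v|mu v]; first exact: (J0 (z, v)).
under eq_fun do rewrite IS.
have mGv : measurable_fun [set: Z * T i]
    (fun p => iter_int int s (fun w => F (p.1, w)) (dfwith v i p.2)).
  apply: (measurableT_comp mG
    (g := fun p : Z * T i => ((p.1, v : pi_type T), p.2))).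
  by repeat apply: measurable_fun_pair.
by have [_ _ ->] := tint mGv (fun=> I0 _ _).
Qed.

Lemma tonelli_iter_int s (v : pi_type T) :
  tonelli (fun F : pi_type T -> \bar R => iter_int int s F v).
Proof.
move=> d' Z F mF F0; have [mI I0 IS] := iter_int_tonelli_aux s mF F0.
split => //.
apply: (measurableT_comp mI (g := fun z : Z => (z, v))).
exact: measurable_fun_pair.
Qed.

(** [J] is moved past one coordinate at a time. *)
Lemma commuting_iter_int d' (Z : measurableType d')
    (J : (Z -> \bar R) -> \bar R) s (v : pi_type T) :
  tonelli J -> (forall i, commuting J (int i)) ->
  commuting J (fun F : pi_type T -> \bar R => iter_int int s F v).
Proof.
move=> tJ cJ F mF F0; elim: s v => [//|i s IH] v /=.
have [mI I0 _] := iter_int_tonelli_aux s mF F0.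
rewrite (cJ i (fun p =>
  iter_int int s (fun w => F (p.1, w)) (dfwith v i p.2)))//.
  congr int; apply/funext => y; exact: (IH (dfwith v i y)).
apply: (measurableT_comp mI
  (g := fun p : Z * T i => (p.1, dfwith v i p.2 : pi_type T))).
apply: measurable_fun_pair => //.
apply: (measurableT_comp (measurable_dfwith (i := i))
  (g := fun p : Z * T i => (v : pi_type T, p.2))).
exact: measurable_fun_pair.
Qed.

(** Coordinates outside [s] stay frozen at their value in [v]. This later gives access to the fact
    that the variance of node 1 equals 1. *)
Lemma eq_iter_int s (F G : pi_type T -> \bar R) (v : pi_type T) :
  (forall w : pi_type T, (forall i, i \notin s -> w i = v i) -> F w = G w) ->
  iter_int int s F v = iter_int int s G v.
Proof.
elim: s v => [|i s IH] v FG /=; first exact: FG.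
congr int; apply/funext => x; apply: IH => w wE; apply: FG => j.
rewrite inE negb_or => /andP[ji js]; rewrite wE// dfwithout//.
by rewrite eq_sym.
Qed.

Lemma dfwithC (v : pi_type T) i j (x : T i) (y : T j) : i != j ->
  dfwith (dfwith v i x) j y = dfwith (dfwith v j y) i x.
Proof.
move=> ij; apply: functional_extensionality_dep => k.
have [<-|jk] := eqVneq j k.
  by rewrite dfwithin dfwithout// dfwithin.
rewrite dfwithout//; have [<-|ik] := eqVneq i k.
  by rewrite !dfwithin.
by rewrite !dfwithout.
Qed.

Lemma iter_int_dfwith s (F : pi_type T -> \bar R) (v : pi_type T) i (x : T i) :
  i \notin s -> iter_int int s F (dfwith v i x) =
  iter_int int s (fun w => F (dfwith w i x)) v.
Proof.
elim: s v => [//|j s IH] v; rewrite inE negb_or => /andP[ij js] /=.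
by congr int; apply/funext => y; rewrite dfwithC// IH.
Qed.

(** Moves coordinate [i] to the innermost position, so that a single vector of coefficients can be
    integrated before all the others. *)
Lemma iter_int_rem s i (F : pi_type T -> \bar R) (v : pi_type T) :
  (forall j k, commuting (int j) (int k)) ->
  measurable_fun setT F -> (forall x, 0 <= F x)%E -> uniq s -> i \in s ->
  iter_int int s F v =
  iter_int int (rem i s) (fun w => int i (fun x => F (dfwith w i x))) v.
Proof.
move=> cint mF F0; elim: s v => [//|j s IH] v /= /andP[js us].
rewrite inE; have [ij _|ij /=] := eqVneq i j; last first.
  by move=> si; congr int; apply/funext => y; rewrite IH.
(* When [i] comes first, its update can be pushed inside the other integrals, and [int i] then
   commutes with all of them. *)
subst j; under eq_fun do rewrite iter_int_dfwith//.
apply: (commuting_iter_int s v (tint (i := i)) (cint i)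
  (F := fun p => F (dfwith p.2 i p.1))) => //.
apply: (measurableT_comp mF).
apply: (measurableT_comp (measurable_dfwith (i := i))
  (g := fun p : T i * pi_type T => (p.2, p.1))).
exact: measurable_fun_pair.
Qed.

End iter_int.

(** * Measurable functions of matrices *)

Section measurable_real.
Variable R : realType.

(** Real powers are measurable, and the product form below is also correct at 0, where the inverse
    is 0 by convention. *)
Lemma measurable_invr : measurable_fun [set: R] (fun x => x^-1).
Proof.
have -> : (fun x : R => x^-1) = (fun x => x * (x ^+ 2) `^ (-1)).
  apply/funext => x; rewrite powR_inv1 ?sqr_ge0//.
  have [->|x0] := eqVneq x 0; first by rewrite invr0 mul0r.
  by rewrite -exprVn expr2 mulrA divff// mul1r.
apply: measurable_funM => //.
by apply: (measurableT_comp (measurable_powR _)); exact: exprn_measurable.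
Qed.

(** The square root of a negative number is 0, hence the truncation by [Num.max]. *)
Lemma measurable_sqrtr : measurable_fun [set: R] (@Num.sqrt R).
Proof.
have -> : @Num.sqrt R = (fun x => (Num.max x 0) `^ 2^-1).
  apply/funext => x; rewrite powR12_sqrt ?le_max ?lexx ?orbT//.
  by case: leP => // x0; rewrite ler0_sqrtr// sqrtr0.
by apply: (measurableT_comp (measurable_powR _)); exact: measurable_maxr.
Qed.

End measurable_real.

Section measurable_mx.
Context (R : realType) (d : measure_display) (Z : measurableType d).

Lemma measurable_mx_entry m n i j :
  measurable_fun setT (fun M : 'M[R]_(m, n) => M i j).
Proof.
move=> _ A mA; apply: sub_sigma_algebra; exists (i, j) => //.
by exists A.
Qed.

Lemma measurable_fun_mxP m n (f : Z -> 'M[R]_(m, n)) :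
  (forall i j, measurable_fun setT (fun z => f z i j)) <->
  measurable_fun setT f.
Proof.
split=> [mf|mf i j]; last exact: (measurableT_comp (measurable_mx_entry i j)).
apply: (measurability (\bigcup_(ij in [set: 'I_m * 'I_n])
  preimage_set_system setT (fun M : 'M[R]_(m, n) => M ij.1 ij.2) measurable)).
  by [].
move=> _ [_ [ij _ [A mA <-]] <-]; rewrite !setTI -comp_preimage.
by rewrite -[X in measurable X]setTI; exact: mf.
Qed.

Lemma measurable_fun_matrix m n (f : Z -> 'I_m -> 'I_n -> R) :
  (forall i j, measurable_fun setT (fun z => f z i j)) ->
  measurable_fun setT (fun z => \matrix_(i, j) f z i j).
Proof.
move=> mf; apply/measurable_fun_mxP => i j; under eq_fun do rewrite mxE.
exact: mf.
Qed.

Lemma measurable_fun_mulmx m n p (f : Z -> 'M[R]_(m, n))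
    (g : Z -> 'M[R]_(n, p)) :
  measurable_fun setT f -> measurable_fun setT g ->
  measurable_fun setT (fun z => f z *m g z).
Proof.
move=> /measurable_fun_mxP mf /measurable_fun_mxP mg.
apply/measurable_fun_mxP => i j; under eq_fun do rewrite mxE.
by apply: measurable_sum => k; exact: measurable_funM.
Qed.

Lemma measurable_fun_addmx m n (f g : Z -> 'M[R]_(m, n)) :
  measurable_fun setT f -> measurable_fun setT g ->
  measurable_fun setT (fun z => f z + g z).
Proof.
move=> /measurable_fun_mxP mf /measurable_fun_mxP mg.
apply/measurable_fun_mxP => i j; under eq_fun do rewrite mxE.
exact: measurable_funD.
Qed.

Lemma measurable_fun_oppmx m n (f : Z -> 'M[R]_(m, n)) :
  measurable_fun setT f -> measurable_fun setT (fun z => - f z).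
Proof.
move=> /measurable_fun_mxP mf.
apply/measurable_fun_mxP => i j; under eq_fun do rewrite mxE.
exact: measurableT_comp.
Qed.

Lemma measurable_fun_trmx m n (f : Z -> 'M[R]_(m, n)) :
  measurable_fun setT f -> measurable_fun setT (fun z => (f z)^T).
Proof.
move=> /measurable_fun_mxP mf.
apply/measurable_fun_mxP => i j; under eq_fun do rewrite mxE.
exact: mf.
Qed.

Lemma measurable_fun_mxsub m n m' n' (h : 'I_m' -> 'I_m) (k : 'I_n' -> 'I_n)
    (f : Z -> 'M[R]_(m, n)) :
  measurable_fun setT f -> measurable_fun setT (fun z => mxsub h k (f z)).
Proof.
move=> /measurable_fun_mxP mf.
apply/measurable_fun_mxP => i j; under eq_fun do rewrite mxE.
exact: mf.
Qed.

Lemma measurable_fun_scalemx m n (c : Z -> R) (f : Z -> 'M[R]_(m, n)) :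
  measurable_fun setT c -> measurable_fun setT f ->
  measurable_fun setT (fun z => c z *: f z).
Proof.
move=> mc /measurable_fun_mxP mf.
apply/measurable_fun_mxP => i j; under eq_fun do rewrite mxE.
exact: measurable_funM.
Qed.

Lemma measurable_fun_scalar_mx n (c : Z -> R) :
  measurable_fun setT c -> measurable_fun setT (fun z => (c z)%:M : 'M[R]_n).
Proof.
move=> mc; apply/measurable_fun_mxP => i j.
under eq_fun do rewrite mxE; case: (i == j).
  by under eq_fun do rewrite mulr1n.
exact: measurable_cst.
Qed.

Lemma measurable_fun_det n (f : Z -> 'M[R]_n) :
  measurable_fun setT f -> measurable_fun setT (fun z => \det (f z)).
Proof.
move=> /measurable_fun_mxP mf; apply: measurable_sum => s.
by apply: measurable_funM => //; exact: measurable_prod.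
Qed.

Lemma measurable_fun_invmx n (f : Z -> 'M[R]_n) :
  measurable_fun setT f -> measurable_fun setT (fun z => invmx (f z)).
Proof.
move=> mf; have mdet := measurable_fun_det mf.
(* By definition [invmx] is the adjugate divided by the determinant on invertible matrices, and the
   matrix itself elsewhere. *)
apply: measurable_fun_ifT => //.
  under eq_fun do rewrite unitmxE unitfE.
  apply: (measurableT_comp (f := negb)) => //.
  by apply: measurable_fun_eqr.
apply: measurable_fun_scalemx.
  exact: (measurableT_comp (@measurable_invr R)).
apply/measurable_fun_mxP => i j; under eq_fun do rewrite mxE.
apply: measurable_funM => //; apply: measurable_fun_det.
apply/measurable_fun_mxP => k l; under eq_fun do rewrite !mxE.
by move: mf => /measurable_fun_mxP; exact.
Qed.

Lemma measurable_fun_mvnormal_pdf n (m : Z -> 'cV[R]_n) (S : Z -> 'M[R]_n)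
    (x : Z -> 'cV[R]_n) :
  measurable_fun setT m -> measurable_fun setT S -> measurable_fun setT x ->
  measurable_fun setT (fun z => mvnormal_pdf (m z) (S z) (x z)).
Proof.
move=> mm mS mx; apply: measurable_funM.
  apply: (measurableT_comp (@measurable_invr R)).
  apply: (measurableT_comp (@measurable_sqrtr R)).
  by apply: measurable_funM => //; exact: measurable_fun_det.
apply: (measurableT_comp (@measurable_expR R)).
apply: measurableT_comp => //; apply: measurable_funM => //.
have mxm : measurable_fun setT (fun z => x z - m z).
  by apply: measurable_fun_addmx => //; exact: measurable_fun_oppmx.
have := measurable_fun_mulmx (measurable_fun_mulmx
  (measurable_fun_trmx mxm) (measurable_fun_invmx mS)) mxm.
by move=> /measurable_fun_mxP; exact.
Qed.

End measurable_mx.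

(** * Lebesgue integrals over matrices *)

Section mx_int.
Variable R : realType.

Let measurable_mx_of_pi m n : measurable_fun setT
  (fun v : pi_type (fun _ : 'I_m * 'I_n => measurableTypeR R) =>
     \matrix_(i, j) v (i, j) : 'M[R]_(m, n)).
Proof.
apply: measurable_fun_matrix => i j.
exact: (measurable_proj_pi (i := (i, j))).
Qed.

Lemma tonelli_mx_int m n : tonelli (@mx_int R m n).
Proof.
exact: (tonelli_comp (tonelli_iter_int
  (T := fun _ : 'I_m * 'I_n => measurableTypeR R)
  (fun=> @tonelli_real_int R) _ _) (@measurable_mx_of_pi m n)).
Qed.

Lemma commuting_mx_int d (T : measurableType d) (J : (T -> \bar R) -> \bar R)
  m n : tonelli J -> commuting J (@mx_int R m n).
Proof.
move=> tJ; exact: (commuting_comp (@measurable_mx_of_pi m n)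
  (commuting_iter_int (T := fun _ : 'I_m * 'I_n => measurableTypeR R)
    (fun=> @tonelli_real_int R) _ _ tJ (fun=> commuting_real_int tJ))).
Qed.

(** Renaming of the integration variables along an injection. [F] and [G] are compared only at
    points that correspond on the integrated coordinates and sit at the base points elsewhere. *)
Lemma iter_int_reindex (I I' : eqType) (h : I -> I') (s : seq I)
    (int : (R -> \bar R) -> \bar R) (F : (I' -> R) -> \bar R)
    (G : (I -> R) -> \bar R) (v : I' -> R) (u : I -> R) : injective h ->
  (forall w' w, (forall i, i \in s -> w' (h i) = w i) ->
     (forall i', i' \notin map h s -> w' i' = v i') ->
     (forall i, i \notin s -> w i = u i) -> F w' = G w) ->
  iter_int (T := fun=> R) (fun=> int) (map h s) F v =
  iter_int (T := fun=> R) (fun=> int) s G u.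
Proof.
move=> hI; elim: s v u => [|i s IH] v u FG /=.
  by apply: FG => // i; rewrite in_nil.
congr int; apply/funext => x; apply: IH => w' w ws wv wu; apply: FG => [j|j|j].
- rewrite inE => /predU1P[->{j}|/ws//].
  have [/ws//|si] := boolP (i \in s).
  by rewrite wv ?mem_map// wu// !dfwithin.
- rewrite /= inE negb_or => /andP[ji js].
  by rewrite wv// dfwithout// eq_sym.
- rewrite inE negb_or => /andP[ji js].
  by rewrite wu// dfwithout// eq_sym.
Qed.

Lemma mx_int_cVS n (F : 'cV[R]_(1 + n) -> \bar R) :
  mx_int F = real_int (fun x => mx_int (fun y => F (col_mx x%:M y))).
Proof.
(* [h] embeds the indices of the lower block [y] into those of the whole column. *)
pose h (p : 'I_n * 'I_1) : 'I_n.+1 * 'I_1 := (lift ord0 p.1, p.2).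
have hI : injective h by move=> [i j] [i' j'] [] /addnI/val_inj -> ->.
(* With a single column, pairs are enumerated in the order of the rows, so (0, 0) comes first and
   the image of [h] follows. *)
have enumE k : enum {: 'I_k * 'I_1} = [seq (i, ord0) | i <- enum 'I_k].
  rewrite enumT unlock /= /prod_enum; elim: (enum 'I_k) => [//|i s /= ->].
  by rewrite enum_ordSl /= enum_ord0.
have -> : mx_int F = real_int (fun x => iter_int (fun=> @real_int R)
    (map h (enum {: 'I_n * 'I_1})) (fun v => F (\matrix_(i, j) v (i, j)))
    (dfwith (fun=> 0) (ord0, ord0) x)).
  rewrite /mx_int (enumE n) (enumE (1 + n)%N) enum_ordSl /= -!map_comp.
  by congr real_int.
congr real_int; apply/funext => x.
apply: iter_int_reindex => // w' w ww' wv _; congr F.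
apply/matrixP => i j; rewrite (ord1 j) !mxE.
case: splitP => k ik.
  have -> : i = ord0 by apply/val_inj; rewrite /= ik (ord1 k).
  rewrite wv ?dfwithin ?(ord1 k) ?mxE//.
  by apply/negP => /mapP[p _ []].
have -> : i = lift ord0 k by apply/val_inj; rewrite /= ik.
by rewrite mxE -ww'// mem_enum.
Qed.

End mx_int.

(** * Change of variables under a law given by a density *)

Section change_of_variables.
Variable R : realType.

(** A nonnegative [e], possibly infinite, is the length of the interval from 0 to [e]. *)
Lemma layer_cake (e : \bar R) : (0 <= e)%E ->
  (\int[@lebesgue_measure R]_x (\1_[set t : R | 0 <= t /\ (t%:E < e)%E] x)%:E)%E
    = e.
Proof.
(* The second factor is everything or empty; it settles the case of minus infinity, where the [else]
   branch alone would give a half-line. *)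
have -> : [set t : R | 0 <= t /\ (t%:E < e)%E] =
    [set` Interval (BLeft 0) (if e is r%:E then BLeft r else +oo%O)]
    `&` [set _ | (0 <= e)%E].
  apply/seteqP; split=> t /=; rewrite in_itv /=.
    move=> [t0 te]; have e0 : (0 <= e)%E by rewrite (le_trans _ (ltW te)).
    split => //; rewrite t0; case: e te {e0} => [r||]//=.
  by case: e => [r||] [] /= /andP[-> h] // _; rewrite ltry.
move=> e0; rewrite (_ : [set _ | (0 <= e)%E] = setT); last first.
  by apply/seteqP; split.
rewrite setIT integral_indic// setIT /= lebesgue_measure_itv /=.
case: e e0 => [r||]//= e0; rewrite ?lte_fin ?ltry ?sube0//.
case: ltP => [//|r0].
by congr EFin; apply/eqP; rewrite eq_le r0 -lee_fin e0.
Qed.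

Context d (Omega : measurableType d) d' (Z : measurableType d').
Context d1 (T : measurableType d1) (J : (T -> \bar R) -> \bar R).
Hypothesis tJ : tonelli J.
Variables (mu : {sigma_finite_measure set Omega -> \bar R}).
Variables (Y : Omega -> Z) (f : T -> Z) (w : T -> R).
Hypotheses (mY : measurable_fun setT Y) (mf : measurable_fun setT f).
Hypotheses (mw : measurable_fun setT w) (w0 : forall t, 0 <= w t).
Hypothesis muY : forall B, measurable B ->
  mu (Y @^-1` B) = J (fun t => (w t * \1_B (f t))%:E).

(* Tonelli is the only property of J at hand, so h is reached from indicators
   through the layer-cake formula rather than by simple functions. *)
Lemma integral_density (h : Z -> \bar R) :
  measurable_fun setT h -> (forall z, 0 <= h z)%E ->
  (\int[mu]_o h (Y o))%E = J (fun t => (w t)%:E * h (f t))%E.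
Proof.
move=> mh h0.
(* The region under the graph of [h], whose section at height [t] is the superlevel set of [h] at
   [t]. *)
pose G := [set p : R * Z | 0 <= p.1 /\ (p.1%:E < h p.2)%E].
have mG : measurable G.
  have -> : G = [set p : R * Z | 0 <= p.1] `&` [set p | (p.1%:E < h p.2)%E].
    by [].
  apply: measurableI.
    rewrite -[X in measurable X]setTI.
    have -> : [set p : R * Z | 0 <= p.1] = fst @^-1` `[0, +oo[.
      by apply/seteqP; split=> p /=; rewrite in_itv /= andbT.
    exact: measurable_fst.
  rewrite -[X in measurable X]setTI; apply: measurable_lte => //.
    by apply/measurable_EFinP; exact: measurable_fst.
  exact: measurableT_comp.
have m1G : measurable_fun setT (\1_G : R * Z -> R) by exact: measurable_indic.
have hE z : h z = (\int[@lebesgue_measure R]_t (\1_G (t, z))%:E)%E.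
  by rewrite -[LHS]layer_cake.
transitivity (\int[mu]_o \int[@lebesgue_measure R]_t (\1_G (t, Y o))%:E)%E.
  by apply: eq_integral => o _.
(* Integrating over heights last leaves probabilities of superlevel sets, to which [muY] applies;
   [ST] below is the same swap on the side of [J]. *)
rewrite (fubini_tonelli (m1 := mu) (m2 := @lebesgue_measure R)
  (fun p => (\1_G (p.2, Y p.1))%:E)); last 2 first.
- apply/measurable_EFinP; apply: (measurableT_comp m1G).
  by apply: measurable_fun_pair => //; exact: measurableT_comp.
- by move=> p; rewrite lee_fin.
have mF : measurable_fun [set: measurableTypeR R * T]
    (fun p => (w p.2 * \1_G (p.1, f p.2))%:E).
  apply/measurable_EFinP; apply: measurable_funM; first exact: measurableT_comp.
  apply: (measurableT_comp m1G); apply: measurable_fun_pair => //.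
  exact: measurableT_comp.
have F0 p : (0 <= (w p.2 * \1_G (p.1, f p.2))%:E :> \bar R)%E.
  by rewrite lee_fin mulr_ge0.
have [_ _ /(_ (@lebesgue_measure R)) ST] := tJ mF F0.
transitivity (\int[@lebesgue_measure R]_t
    J (fun x => (w x * \1_G (t, f x))%:E))%E; last first.
  rewrite -ST; congr J; apply/funext => x /=.
  under eq_integral do rewrite EFinM.
  rewrite ge0_integralZl_EFin//; first by rewrite -hE.
  apply/measurable_EFinP; apply: (measurableT_comp m1G).
  exact: measurable_fun_pair.
apply: eq_integral => t _ /=.
have mxG : measurable (xsection G t) by exact: measurable_xsection.
have GE z : \1_G (t, z) = \1_(xsection G t) z :> R.
  by rewrite !indicE mem_xsection.
under eq_integral do rewrite GE.
have -> : (fun x => (\1_(xsection G t) (Y x))%:E : \bar R) =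
  (fun x => (\1_(Y @^-1` xsection G t) x)%:E) by [].
rewrite integral_indic//; last first.
  by rewrite -[X in measurable X]setTI; exact: mY.
rewrite setIT; etransitivity; first exact: muY.
by congr J; apply/funext => x; rewrite GE.
Qed.

End change_of_variables.

(** * Gaussian integrals *)

Section gaussian.
Variable R : realType.

Lemma real_int_gaussian (al m : R) : 0 < al ->
  real_int (fun x => (expR (- (al * (x - m) ^+ 2 / 2)))%:E) =
  (Num.sqrt (2 * pi / al))%:E.
Proof.
(* [s] is the standard deviation that corresponds to the precision [al]. *)
move=> al0; pose s := (Num.sqrt al)^-1.
have s0 : s != 0 by rewrite invr_neq0// sqrtr_eq0 -ltNge.
have s2 : s ^+ 2 = al^-1 by rewrite exprVn sqr_sqrtr// ltW.
have pk : normal_peak s = (Num.sqrt (2 * pi / al))^-1.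
  by rewrite /normal_peak s2; congr (Num.sqrt _)^-1; rewrite -mulr_natl; ring.
have pk0 : 0 < normal_peak s by exact: normal_peak_gt0.
have fE x : expR (- (al * (x - m) ^+ 2 / 2)) = normal_fun m s x.
  by congr expR; rewrite s2 -mulr_natl; field; rewrite gt_eqF.
have pdfE x : expR (- (al * (x - m) ^+ 2 / 2)) =
    (normal_peak s)^-1 * normal_pdf m s x.
  by rewrite fE normal_pdfE// mulrA mulVf ?mul1r// gt_eqF.
rewrite /real_int; under eq_integral do rewrite pdfE EFinM.
rewrite ge0_integralZl_EFin//.
- by rewrite integral_normal_pdf mule1 pk invrK.
- by move=> x _; rewrite lee_fin normal_pdf_ge0.
- by apply/measurable_EFinP; exact: measurable_normal_pdf.
- by rewrite invr_ge0 ltW.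
Qed.

Definition posdef n (T : 'M[R]_n) := T^T = T /\
  forall x : 'cV[R]_n, x != 0 -> 0 < (x^T *m T *m x) 0 0.

Lemma quadform_block_diag n (s u : R) (S : 'M[R]_n) (z : 'cV[R]_n) :
  ((col_mx u%:M z)^T *m block_mx s%:M 0 0 S *m col_mx u%:M z) 0 0 =
  s * u ^+ 2 + (z^T *m S *m z) 0 0.
Proof.
rewrite tr_col_mx mul_row_block mul_row_col !mulmx0 addr0 add0r mxE.
congr (_ + _); rewrite tr_scalar_mx -!scalar_mxM mxE eqxx mulr1n; ring.
Qed.

Lemma posdef_drsubmx n (T : 'M[R]_(1 + n)) : posdef T -> posdef (drsubmx T).
Proof.
move=> [Tsym Tpos]; split=> [|y y0]; first by rewrite trmx_drsub Tsym.
have x0 : col_mx 0 y != 0 :> 'cV[R]_(1 + n).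
  rewrite -col_mx0; apply/eqP => /eq_col_mx[_ ye].
  by rewrite ye eqxx in y0.
have := Tpos _ x0; rewrite -{1}[T]submxK tr_col_mx mul_row_block mul_row_col.
by rewrite trmx0 !mul0mx mulmx0 !add0r.
Qed.

(** Block elimination of the first coordinate: [c] solves S c = b for the lower-left block b of [T],
    and [s] is the Schur complement of S. *)
Lemma posdef_schur n (T : 'M[R]_(1 + n)) : posdef T -> drsubmx T \in unitmx ->
  exists c s, 0 < s /\ T = (block_mx 1%:M 0 c 1%:M)^T *m
    block_mx s%:M 0 0 (drsubmx T) *m block_mx 1%:M 0 c 1%:M.
Proof.
move=> [Tsym Tpos]; set S := drsubmx T => Su.
pose c := invmx S *m dlsubmx T.
pose s := (ulsubmx T - c^T *m S *m c) 0 0.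
exists c, s; set L := block_mx 1%:M 0 c 1%:M.
have TE := submxK T.
set a := ulsubmx T in TE s *; set b := dlsubmx T in TE c L s *.
rewrite -/S in TE.
have Ssym : S^T = S by rewrite /S trmx_drsub Tsym.
have bT : ursubmx T = b^T by rewrite /b trmx_dlsub Tsym.
have Sc : S *m c = b by rewrite mulKVmx.
have cS : c^T *m S = b^T by rewrite -[in LHS]Ssym -trmx_mul Sc.
have TL : T = L^T *m block_mx s%:M 0 0 S *m L.
  rewrite -TE bT /L tr_block_mx !trmx1 trmx0 !mulmx_block.
  rewrite !mulmx0 !mul0mx !mulmx1 !mul1mx !addr0 !add0r cS Sc.
  congr block_mx; rewrite -mx11_scalar; first by rewrite cS subrK.
have Tquad (x : 'cV[R]_(1 + n)) : (x^T *m T *m x) 0 0 =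
    ((L *m x)^T *m block_mx s%:M 0 0 S *m (L *m x)) 0 0.
  by rewrite [in LHS]TL trmx_mul !mulmxA.
split => //.
(* [L] sends the vector (1, -c) to (1, 0), where the block diagonal form takes the value [s]; hence
   [s] is positive. *)
have x0 : col_mx 1%:M (- c) != 0 :> 'cV[R]_(1 + n).
  rewrite -col_mx0; apply/eqP => /eq_col_mx[/matrixP/(_ 0 0)].
  by rewrite !mxE => /eqP; rewrite oner_eq0.
have := Tpos _ x0; rewrite Tquad /L mul_block_col !mulmx1 mul0mx addr0 mul1mx.
rewrite addrN quadform_block_diag trmx0 !mul0mx mxE addr0.
by rewrite expr1n mulr1.
Qed.

(** The sign of the determinant belongs to the same induction: it makes the trailing block
    invertible, which the Schur complement requires. *)
Lemma mx_int_gaussian n (T : 'M[R]_n) : posdef T ->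
  0 < \det T /\ forall m : 'cV[R]_n,
    mx_int (fun x => (expR (- (((x - m)^T *m T *m (x - m)) 0 0 / 2)))%:E) =
    (Num.sqrt ((2 * pi) ^+ n / \det T))%:E.
Proof.
elim: n T => [T _|n IH].
  split=> [|m]; first by rewrite det_mx00.
  rewrite /mx_int /=.
  (* In dimension 0 there is no coordinate, and the integral is the value at the empty vector. *)
  rewrite (_ : enum _ = [::]); last first.
    by apply/eqP; rewrite -size_eq0 -cardT card_prod card_ord.
  by rewrite /= mxE big_ord0 mul0r oppr0 expR0 expr0 det_mx00 divr1 sqrtr1.
rewrite -[n.+1]/(1 + n)%N => T Tp.
have Sp := posdef_drsubmx (n := n) Tp.
have H := posdef_schur (n := n) Tp.
set S := drsubmx _ in Sp H.
have [Sdet Sint] := IH _ Sp.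
have Su : S \in unitmx by rewrite unitmxE unitfE gt_eqF.
have {H} [c [s [s0 TE]]] := H Su.
have Tdet : \det T = s * \det S.
  rewrite TE !det_mulmx det_tr !det_lblock !det1 det_scalar1.
  by rewrite !mul1r mulr1.
split=> [|m]; first by rewrite Tdet mulr_gt0.
rewrite mx_int_cVS.
pose m0 := usubmx (m : 'cV[R]_(1 + n)) 0 0.
pose m1 := dsubmx (m : 'cV[R]_(1 + n)).
(* For fixed [u] this is a Gaussian exponent in [y] with a shifted centre. The integral over [y]
   does not depend on the centre, so only the first term keeps [u]. *)
have quad u y : (((col_mx u%:M y : 'cV[R]_(1 + n)) - m)^T *m T *m
    (col_mx u%:M y - m)) 0 0 =
  s * (u - m0) ^+ 2 + ((y - (m1 - (u - m0) *: c))^T *m S *m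
    (y - (m1 - (u - m0) *: c))) 0 0.
  have -> : (col_mx u%:M y : 'cV[R]_(1 + n)) - m = col_mx (u - m0)%:M (y - m1).
    rewrite -[m]vsubmxK opp_col_mx add_col_mx; congr col_mx.
    by rewrite raddfB /=; congr (_ - _); rewrite [LHS]mx11_scalar.
  rewrite [in LHS]TE -!mulmxA [in LHS]mulmxA -trmx_mul mul_block_col.
  rewrite !mul1mx mul0mx addr0.
  rewrite mulmxA quadform_block_diag mul_mx_scalar.
  by rewrite opprB !addrA [_ *: c + y]addrC mulmxA.
have intE u : mx_int (fun y => (expR (- (((col_mx u%:M y - m)^T *m T *m
      (col_mx u%:M y - m)) 0 0 / 2)))%:E) =
    ((Num.sqrt ((2 * pi) ^+ n / \det S))%:E *
      (expR (- (s * (u - m0) ^+ 2 / 2)))%:E)%E.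
  under [X in mx_int X]eq_fun do rewrite quad mulrDl opprD expRD EFinM.
  rewrite (tonelliZl (@tonelli_mx_int R n 1)).
  - by rewrite Sint muleC.
  - exact: expR_ge0.
  - apply/measurable_EFinP; apply: (measurableT_comp (@measurable_expR R)).
    apply: measurableT_comp => //; apply: measurable_funM => //.
    have my : measurable_fun setT
        (fun y : 'cV[R]_n => y - (m1 - (u - m0) *: c)).
      by apply: measurable_fun_addmx.
    by have /measurable_fun_mxP := measurable_fun_mulmx (measurable_fun_mulmx
      (measurable_fun_trmx my) (measurable_cst S)) my; exact.
  - by move=> x; rewrite lee_fin expR_ge0.
under eq_fun do rewrite intE.
rewrite (tonelliZl (@tonelli_real_int R)).
- rewrite real_int_gaussian// -EFinM -sqrtrM; last first.
    by rewrite divr_ge0 ?exprn_ge0 ?mulr_ge0 ?pi_ge0// ltW.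
  congr (Num.sqrt _)%:E; rewrite Tdet exprS.
  by field; rewrite !gt_eqF.
- exact: sqrtr_ge0.
- apply/measurable_EFinP; apply: (measurableT_comp (@measurable_expR R)).
  apply: measurableT_comp => //; do 2 apply: measurable_funM => //.
  by apply: measurable_funX; exact: measurable_funB.
- by move=> x; rewrite lee_fin expR_ge0.
Qed.

End gaussian.

(** * Multivariate normal distributions and conjugacy *)

Section mvnormal.
Variable R : realType.

Lemma mvnormal_pdf_ge0 n (m : 'cV[R]_n) S x : 0 <= mvnormal_pdf m S x.
Proof. by rewrite mulr_ge0 ?expR_ge0// invr_ge0 sqrtr_ge0. Qed.

Lemma posdef_unitmx n (T : 'M[R]_n) : posdef T -> T \in unitmx.
Proof. by move=> /mx_int_gaussian[T0 _]; rewrite unitmxE unitfE gt_eqF. Qed.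

Lemma posdefZ n (T : 'M[R]_n) (c : R) : 0 < c -> posdef T -> posdef (c *: T).
Proof.
move=> c0 [Tsym Tpos]; split=> [|x x0]; first by rewrite linearZ/= Tsym.
by rewrite -scalemxAr -scalemxAl mxE mulr_gt0// Tpos.
Qed.

(** Positive definiteness is asked of the precision matrix, since that is the matrix in the
    exponent; the determinant of [S] is recovered as the inverse of its determinant. *)
Lemma mx_int_mvnormal_pdf n (m : 'cV[R]_n) (S : 'M[R]_n) : posdef (invmx S) ->
  mx_int (fun x => (mvnormal_pdf m S x)%:E) = 1%E.
Proof.
move=> Sp; have [+ Gint] := mx_int_gaussian Sp; rewrite det_inv => dS.
have dS0 : 0 < \det S by rewrite -invr_gt0.
under [X in mx_int X]eq_fun do rewrite /mvnormal_pdf EFinM.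
rewrite (tonelliZl (@tonelli_mx_int R n 1)).
- rewrite Gint det_inv invrK -EFinM mulVf// gt_eqF// sqrtr_gt0.
  by rewrite mulr_gt0// exprn_gt0// mulr_gt0// pi_gt0.
- by rewrite invr_ge0 sqrtr_ge0.
- apply/measurable_EFinP; apply: (measurableT_comp (@measurable_expR R)).
  apply: measurableT_comp => //; apply: measurable_funM => //.
  have mx : measurable_fun setT (fun x : 'cV[R]_n => x - m).
    by apply: measurable_fun_addmx.
  by have /measurable_fun_mxP := measurable_fun_mulmx (measurable_fun_mulmx
    (measurable_fun_trmx mx) (measurable_cst (invmx S))) mx; exact.
- by move=> x; rewrite lee_fin expR_ge0.
Qed.

Lemma iter_int_ge0 (I : eqType) (T : I -> Type)
    (int : forall i, (T i -> \bar R) -> \bar R) s F v :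
  (forall i G, (forall x, 0 <= G x)%E -> (0 <= int i G)%E) ->
  (forall w, 0 <= F w)%E -> (0 <= iter_int int s F v)%E.
Proof. by move=> i0 F0; elim: s v => [|i s IH] v //=; exact: i0. Qed.

Lemma mx_int_ge0 m n (F : 'M[R]_(m, n) -> \bar R) :
  (forall x, 0 <= F x)%E -> (0 <= mx_int F)%E.
Proof.
move=> F0; apply: iter_int_ge0 => // _ G G0.
exact: integral_ge0.
Qed.

Lemma measurable_mvnormal_indic n (m : 'cV[R]_n) S (A : set 'cV[R]_n) :
  measurable A ->
  measurable_fun setT (fun x => (mvnormal_pdf m S x * \1_A x)%:E).
Proof.
move=> mA; apply/measurable_EFinP; apply: measurable_funM.
  exact: measurable_fun_mvnormal_pdf.
exact: measurable_indic.
Qed.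

Lemma mvnormal_semi_sigma_additive n (m : 'cV[R]_n) S :
  semi_sigma_additive (mvnormal m S).
Proof.
move=> F mF tF mUF.
have F0 i x : (0 <= (mvnormal_pdf m S x * \1_(F i) x)%:E)%E.
  by rewrite lee_fin mulr_ge0// mvnormal_pdf_ge0.
have -> : mvnormal m S (\bigcup_n F n) = (\sum_(i <oo) mvnormal m S (F i))%E.
  rewrite /mvnormal.
  rewrite -(tonelli_nneseries (@tonelli_mx_int R n 1)
    (F := fun i x => (mvnormal_pdf m S x * \1_(F i) x)%:E))//; last first.
    by move=> i; exact: measurable_mvnormal_indic.
  congr mx_int; apply/funext => x; rewrite EFinM.
  under eq_eseriesr do rewrite EFinM.
  rewrite nneseriesZl//; congr (_ * _)%E.
  (* Additivity of the Dirac mass at [x] expands the indicator of the union into a series of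
     indicators. *)
  have := measure_semi_bigcup (\d_x : measure _ R) mF tF mUF.
  by rewrite /= !diracE indicE => ->.
by apply: is_cvg_ereal_nneg_natsum => i _; exact: mx_int_ge0.
Qed.

Lemma mvnormal_probability n (m : 'cV[R]_n) S : posdef (invmx S) ->
  exists Q : probability 'cV[R]_n R,
    forall A, measurable A -> mvnormal m S A = Q A.
Proof.
move=> Sp.
have m0 : mvnormal m S set0 = 0%E.
  rewrite /mvnormal; under [X in mx_int X]eq_fun do rewrite indic0 mulr0.
  exact: (tonelli0 (@tonelli_mx_int R n 1)).
have mge0 A : (0 <= mvnormal m S A)%E.
  by apply: mx_int_ge0 => x; rewrite lee_fin mulr_ge0// mvnormal_pdf_ge0.
have m1 : mvnormal m S setT = 1%E.
  rewrite /mvnormal; under [X in mx_int X]eq_fun do rewrite indicT mulr1.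
  exact: mx_int_mvnormal_pdf.
pose H1 := isMeasure.Build _ _ R (mvnormal m S) m0 mge0
  (@mvnormal_semi_sigma_additive n m S).
pose M : {measure set 'cV[R]_n -> \bar R} := HB.pack (mvnormal m S) H1.
pose H2 := Measure_isProbability.Build _ _ R M m1.
pose Q : probability 'cV[R]_n R := HB.pack (mvnormal m S) H1 H2.
by exists Q.
Qed.

(** Conjugacy of the Gaussian prior with the Gaussian linear model. Only the sign of [K] and its
    independence of [l] matter afterwards. *)
Lemma mvnormal_pdf_posterior n p (g s : R) (M : 'M[R]_(n, p)) (y : 'cV[R]_n) :
  0 < s ->
  let T := g%:M + M^T *m M in posdef T ->
  exists2 K : R, 0 <= K & forall l : 'cV[R]_p,
    mvnormal_pdf 0 (g^-1 * s)%:M l * mvnormal_pdf (- (M *m l)) s%:M y =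
    K * mvnormal_pdf (- (invmx T *m M^T *m y)) (s *: invmx T) l.
Proof.
move=> s0 T; have TE : T = g%:M + M^T *m M by [].
move: T TE => T TE Tp; have Tu := posdef_unitmx Tp.
have [dT _] := mx_int_gaussian Tp; have [Tsym _] := Tp.
set h := invmx T *m M^T *m y.
have Th : T *m h = M^T *m y by rewrite /h -mulmxA mulKVmx.
have hT : h^T *m T = y^T *m M.
  by rewrite -[T in LHS]Tsym -trmx_mul Th trmx_mul trmxK.
have su : s *: invmx T \in unitmx.
  by rewrite unitmxZ ?unitfE ?gt_eqF// unitmx_inv.
have sinv : invmx (s *: invmx T) = s^-1 *: T by rewrite invmxZ// invmxK.
(* [C] compensates the normalising factor of the posterior density; [A] and [B] are the factors of
   the prior and of the likelihood, and [r] is what remains of the exponent once the square is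
   completed. *)
pose C := Num.sqrt ((2 * pi) ^+ p * \det (s *: invmx T)).
have C0 : 0 < C.
  have dS : 0 < s ^+ p / \det T by rewrite divr_gt0// exprn_gt0.
  by rewrite sqrtr_gt0 detZ det_inv mulr_gt0// exprn_gt0// mulr_gt0// pi_gt0.
pose A := (Num.sqrt ((2 * pi) ^+ p * \det ((g^-1 * s)%:M : 'M[R]_p)))^-1.
pose B := (Num.sqrt ((2 * pi) ^+ n * \det (s%:M : 'M[R]_n)))^-1.
pose r := (y^T *m y) 0 0 - (h^T *m T *m h) 0 0.
have K0 : 0 <= A * B * C * expR (- (s^-1 * r / 2)).
  by rewrite !mulr_ge0 ?expR_ge0 ?invr_ge0 ?sqrtr_ge0// ltW.
exists (A * B * C * expR (- (s^-1 * r / 2))) => // l.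
(* Completing the square: the cross terms agree because T h = M' y. *)
have sq : g * (l^T *m l) 0 0 + ((y + M *m l)^T *m (y + M *m l)) 0 0 =
    ((l + h)^T *m T *m (l + h)) 0 0 + r.
  have -> : g * (l^T *m l) 0 0 = (l^T *m g%:M *m l) 0 0.
    by rewrite mul_mx_scalar -scalemxAl [RHS]mxE.
  have -> : (l^T *m g%:M *m l) 0 0 =
      (l^T *m T *m l) 0 0 - (l^T *m M^T *m M *m l) 0 0.
    by rewrite TE mulmxDr mulmxDl [X in _ = X - _]mxE !mulmxA addrK.
  rewrite /r ![(_ + _)^T]linearD /= !mulmxDl !mulmxDr trmx_mul.
  rewrite hT -[l^T *m T *m h]mulmxA Th !mulmxA !mxE; ring.
rewrite /mvnormal_pdf -/A -/B -/C sinv !invmx_scalar subr0 !opprK.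
rewrite !mul_mx_scalar -!scalemxAr -!scalemxAl.
have scaleE k (c : R) (u : 'M[R]_k) i j : (c *: u) i j = c * u i j.
  by rewrite mxE.
have -> : (A * expR (- (((g^-1 * s)^-1 *: (l^T *m l)) 0 0 / 2)) *
  (B * expR (- ((s^-1 *: ((y + M *m l)^T *m (y + M *m l))) 0 0 / 2)))) =
  A * B * expR (- (s^-1 * (g * (l^T *m l) 0 0 +
    ((y + M *m l)^T *m (y + M *m l)) 0 0) / 2)).
  rewrite !scaleE mulrACA -expRD invfM invrK; congr (_ * expR _); ring.
rewrite sq !scaleE.
have -> : - (s^-1 * (((l + h)^T *m T *m (l + h)) 0 0 + r) / 2) =
  - (s^-1 * r / 2) + - (s^-1 * ((l + h)^T *m T *m (l + h)) 0 0 / 2) by ring.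
rewrite expRD; field; exact: lt0r_neq0.
Qed.

(** The quadratic form at x is g |x|^2 + |M x|^2, whose first term is already positive. *)
Lemma posdef_ridge n p (g : R) (M : 'M[R]_(n, p)) : 0 < g ->
  posdef (g%:M + M^T *m M).
Proof.
move=> g0; split; first by rewrite linearD /= tr_scalar_mx trmx_mul trmxK.
have sqE k (x : 'cV[R]_k) : (x^T *m x) 0 0 = \sum_i x i 0 ^+ 2.
  by rewrite mxE; apply: eq_bigr => i _; rewrite mxE expr2.
move=> x x0; rewrite mulmxDr mulmxDl mul_mx_scalar -scalemxAl.
have -> : x^T *m (M^T *m M) *m x = (M *m x)^T *m (M *m x).
  by rewrite trmx_mul !mulmxA.
rewrite mxE [X in X + _]mxE !sqE ltr_wpDr ?sumr_ge0//.
  by move=> i _; exact: sqr_ge0.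
rewrite mulr_gt0// lt_def sumr_ge0 ?andbT; last by move=> i _; exact: sqr_ge0.
apply: contra x0 => /eqP/psumr_eq0P H; apply/eqP/matrixP => i j.
rewrite (ord1 j) mxE; apply/eqP; rewrite -sqrf_eq0; apply/eqP/H => // k _.
exact: sqr_ge0.
Qed.

End mvnormal.

(** * The two-group model *)

Section densities.
Variable R : realType.

Lemma Gamma_ge0 (s : R) : 0 <= Gamma s.
Proof.
by apply: Rintegral_ge0 => x _; rewrite mulr_ge0 ?powR_ge0 ?expR_ge0.
Qed.

Lemma invgamma_pdf_ge0 (alpha beta x : R) : 0 <= invgamma_pdf alpha beta x.
Proof.
rewrite /invgamma_pdf; case: ifP => // _.
by rewrite !mulr_ge0 ?invr_ge0 ?powR_ge0 ?expR_ge0 ?Gamma_ge0.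
Qed.

Lemma measurable_invgamma_pdf (alpha beta : R) :
  measurable_fun setT (invgamma_pdf alpha beta).
Proof.
apply: measurable_fun_ifT => //; first exact: measurable_fun_ltr.
apply: measurable_funM.
  by apply: measurable_funM => //; exact: measurable_powR.
apply: (measurableT_comp (@measurable_expR R)).
by apply: measurable_funM => //; exact: measurable_invr.
Qed.

Lemma measurable_prod_cond d (T : measurableType d) (I : eqType) (s : seq I)
    (P : pred I) (h : I -> T -> R) :
  (forall i, P i -> measurable_fun setT (h i)) ->
  measurable_fun setT (fun x => \prod_(i <- s | P i) h i x).
Proof.
move=> mh; rewrite (_ : (fun x => _) =
    (fun x => \prod_(i <- s) if P i then h i x else 1)); last first.
  by apply/funext => x; rewrite big_mkcond.
by apply: measurable_prod => i _; case: (boolP (P i)) => // Pi; exact: mh.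
Qed.

End densities.

Local Notation variances R q := (pi_type (fun _ : 'I_q => measurableTypeR R)).
Local Notation coefficients R D := (pi_type (fun p =>
  ('cV[R]_#|pa (D p.1) p.2| : measurableType _))).
Local Notation dataset R q n := (pi_type (fun k : 'I_2 =>
  ('M[R]_(n k, q) : measurableType _))).
Local Notation full R q D n :=
  (variances R q * (coefficients R D * dataset R q n))%type.

(** * The state space and its iterated integral *)

Section model.
Variables (R : realType) (q : nat).
Variables (D : 'I_2 -> rel 'I_q) (n : 'I_2 -> nat) (g : 'I_2 -> R) (a : R).

Definition state_gen : set (set (state R D n)) :=
  [set E | exists S A C,
    [/\ forall j, measurable (S j), forall k j, measurable (A k j),
        forall k, measurable (C k) & E = box S A C]].

(** A named copy of [state] in which [measurable] means [state_measurable], so that preimages under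
    measurable maps are events covered by [two_group_model]. *)
Definition state_type := state R D n.

HB.instance Definition _ := gen_eqMixin state_type.
HB.instance Definition _ := gen_choiceMixin state_type.
HB.instance Definition _ := isPointed.Build state_type
  ((fun=> 0), (fun k j => 0), (fun k => 0)).

Let state_measurable0 : <<s state_gen >> set0.
Proof. exact: sigma_algebra0. Qed.

Let state_measurableC A : <<s state_gen >> A -> <<s state_gen >> (~` A).
Proof. exact: sigma_algebraC. Qed.

Let state_measurable_bigcup (F : (set state_type)^nat) :
  (forall i, <<s state_gen >> (F i)) -> <<s state_gen >> (\bigcup_i (F i)).
Proof. exact: sigma_algebra_bigcup. Qed.

HB.instance Definition _ := @isMeasurable.Build (sigma_display state_gen)
  state_type <<s state_gen >>
  state_measurable0 state_measurableC state_measurable_bigcup.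

(** The preimage is a box with all other sides full, hence a generator; the coefficients and the
    data are treated alike. *)
Lemma measurable_state_sigma j :
  measurable_fun setT (fun t : state_type => t.1.1 j).
Proof.
move=> _ A mA; rewrite setTI; apply: sub_sigma_algebra.
exists (dfwith (fun=> setT) j A), (fun _ _ => setT), (fun=> setT).
split => //.
  by move=> i; have [<-|ji] := eqVneq j i; rewrite ?dfwithin ?dfwithout.
apply/seteqP; split=> [t tA|t [/(_ j)]]; last by rewrite dfwithin.
by split => // i; have [<-|ji] := eqVneq j i; rewrite ?dfwithin ?dfwithout.
Qed.

Lemma measurable_state_coef k j :
  measurable_fun setT (fun t : state_type => t.1.2 k j).
Proof.
move=> _ A mA; rewrite setTI; apply: sub_sigma_algebra.
pose A' := @dfwith _ (fun p => set 'cV[R]_#|pa (D p.1) p.2|)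
  (fun=> setT) (k, j) A.
exists (fun=> setT), (fun k' j' => A' (k', j')), (fun=> setT).
split => //.
  move=> k' j'; rewrite /A'; have [[<- <-]|ne] := eqVneq (k, j) (k', j').
    by rewrite dfwithin.
  by rewrite dfwithout.
apply/seteqP; split=> [t tA|t [_ /(_ k j)]]; last by rewrite /A' dfwithin.
split => // k' j'; rewrite /A'; have [[<- <-]|ne] := eqVneq (k, j) (k', j').
  by rewrite dfwithin.
by rewrite dfwithout.
Qed.

Lemma measurable_state_data k :
  measurable_fun setT (fun t : state_type => t.2 k).
Proof.
move=> _ A mA; rewrite setTI; apply: sub_sigma_algebra.
pose A' := @dfwith _ (fun k => set 'M[R]_(n k, q)) (fun=> setT) k A.
exists (fun=> setT), (fun _ _ => setT), A'.
split => //.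
  move=> k'; rewrite /A'; have [<-|ne] := eqVneq k k'.
    by rewrite dfwithin.
  by rewrite dfwithout.
apply/seteqP; split=> [t tA|t [_ _ /(_ k)]]; last by rewrite /A' dfwithin.
split => // k'; rewrite /A'; have [<-|ne] := eqVneq k k'.
  by rewrite dfwithin.
by rewrite dfwithout.
Qed.

(** The product spaces index coefficients by pairs (k, j), as the integral does, while [state] takes
    the two indices in turn. *)
Definition curry_state (t : full R q D n) : state_type :=
  (t.1, fun k j => t.2.1 (k, j), t.2.2).

Lemma joint_pdf_ge0 s L X : 0 <= joint_pdf (D := D) (n := n) g a s L X.
Proof.
rewrite !mulr_ge0//; repeat (apply: prodr_ge0 => ? _);
  by rewrite ?invgamma_pdf_ge0 ?mvnormal_pdf_ge0.
Qed.

Lemma measurable_joint_pdf :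
  measurable_fun setT (fun t : full R q D n =>
    joint_pdf g a t.1 (curry_state t).1.2 t.2.2).
Proof.
have ms j : measurable_fun setT
    (fun t : full R q D n => t.1 j).
  exact: (measurableT_comp (measurable_proj_pi (i := j)) measurable_fst).
have ml k j : measurable_fun setT
    (fun t : full R q D n => t.2.1 (k, j)).
  apply: (measurableT_comp (measurable_proj_pi (i := (k, j)))
    (measurableT_comp measurable_fst measurable_snd)).
have mx k : measurable_fun setT
    (fun t : full R q D n => t.2.2 k).
  apply: (measurableT_comp (measurable_proj_pi (i := k))
    (measurableT_comp measurable_snd measurable_snd)).
apply: measurable_funM; first apply: measurable_funM.
- apply: measurable_prod_cond => j _.
  exact: (measurableT_comp (measurable_invgamma_pdf _ _) (ms j)).
- apply: measurable_prod_cond => j _; apply: measurable_prod_cond => k _.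
  apply: (measurable_fun_mvnormal_pdf _ _ (ml k j)) => //.
  apply: measurable_fun_scalar_mx.
  exact: (measurable_funM (measurable_cst _) (ms j)).
- apply: measurable_prod_cond => k _; apply: measurable_prod_cond => j _.
  apply: measurable_fun_mvnormal_pdf; first apply: measurable_fun_oppmx.
  + by apply: measurable_fun_mulmx (ml k j); exact: measurable_fun_mxsub (mx k).
  + exact: measurable_fun_scalar_mx (ms j).
  + by apply: measurable_fun_mxsub (mx k).
Qed.

Definition curried_int (F : full R q D n -> \bar R) :=
  iter_int (fun _ : 'I_q => @real_int R)
    [seq j : 'I_q <- enum 'I_q | val j != 0%N]
    (fun s =>
  iter_int (fun p : 'I_2 * 'I_q => @mx_int R #|pa (D p.1) p.2| 1)
    (enum {: 'I_2 * 'I_q})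
    (fun l =>
  iter_int (fun k : 'I_2 => @mx_int R (n k) q) (enum 'I_2)
    (fun X => F (s, (l, X)))
    (fun=> 0))
    (fun=> 0))
    (fun=> 1).

Lemma tonelli_curried_int : tonelli curried_int.
Proof.
have ts := tonelli_iter_int (T := fun _ : 'I_q => measurableTypeR R)
  (int := fun=> @real_int R) (fun=> @tonelli_real_int R).
have tl := tonelli_iter_int (T := fun p : 'I_2 * 'I_q =>
  ('cV[R]_#|pa (D p.1) p.2| : measurableType _))
  (int := fun p => @mx_int R #|pa (D p.1) p.2| 1)
  (fun p => @tonelli_mx_int R _ _).
have tx := tonelli_iter_int (T := fun k : 'I_2 =>
  ('M[R]_(n k, q) : measurableType _))
  (int := fun k => @mx_int R (n k) q) (fun p => @tonelli_mx_int R _ _).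
exact: (tonelli_pair (ts _ _) (tonelli_pair (tl _ _) (tx _ _))).
Qed.

End model.

(** * Factorisation of the joint density at one node *)

Section posterior.
Variables (R : realType) (q : nat).
Variables (D : 'I_2 -> rel 'I_q) (n : 'I_2 -> nat) (g : 'I_2 -> R) (a : R).

(** With p = (k, j), these are all the factors of the joint density in which L_j^(k) occurs. *)
Definition node_pdf (s : 'I_q -> R) (X : data R q n) (p : 'I_2 * 'I_q)
    (x : 'cV[R]_#|pa (D p.1) p.2|) : R :=
  mvnormal_pdf 0 ((g p.1)^-1 * s p.2)%:M x *
  mvnormal_pdf (- (pa_cols (D p.1) (X p.1) p.2 *m x)) (s p.2)%:M
    (col p.2 (X p.1)).

Lemma node_pdf_ge0 s X p x : 0 <= node_pdf s X (p := p) x.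
Proof. by rewrite mulr_ge0// mvnormal_pdf_ge0. Qed.

Lemma joint_pdfE s (l : coefficients R D) X :
  joint_pdf g a s (fun k j => l (k, j)) X =
  sigma_prior D g a s * \prod_p node_pdf s X (l p).
Proof.
rewrite /joint_pdf -mulrA; congr (_ * _).
rewrite big_split /= /coef_prior exchange_big /likelihood !pair_bigA /=.
by congr (_ * _); apply: eq_bigr => -[k j].
Qed.

Lemma joint_pdf_dfwith s (l : coefficients R D) X k j :
  exists2 c : R, 0 <= c & forall x,
    joint_pdf g a s
      (fun k' j' => (dfwith l (k, j) x : coefficients R D) (k', j')) X =
    c * node_pdf s X (p := (k, j)) x.
Proof.
exists (sigma_prior D g a s * \prod_(p | p != (k, j)) node_pdf s X (l p)).
  rewrite mulr_ge0// prodr_ge0// => i _; last exact: node_pdf_ge0.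
  exact: invgamma_pdf_ge0.
move=> x; rewrite joint_pdfE -mulrA; congr (_ * _).
rewrite (bigD1 (k, j))//= dfwithin mulrC; congr (_ * _).
by apply: eq_bigr => p pk; rewrite dfwithout// eq_sym.
Qed.

(** The inverse gamma density vanishes off the positive half-line, so variances at which the normal
    kernel is meaningless carry no mass. *)
Lemma joint_pdf0 s (l : coefs R D) (X : data R q n) (j : 'I_q) :
  (j : nat) <> 0%N -> s j <= 0 -> joint_pdf g a s l X = 0.
Proof.
move=> /eqP j0 sj; rewrite /joint_pdf /sigma_prior (bigD1 j)//=.
by rewrite /invgamma_pdf ltNge sj /= !mul0r.
Qed.

Lemma posdef_Tbar k j (X : 'M[R]_(n k, q)) : 0 < g k -> posdef (Tbar D g j X).
Proof. exact: posdef_ridge. Qed.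

Lemma posdef_invmx_scale k j (X : 'M[R]_(n k, q)) (s : R) : 0 < g k -> 0 < s ->
  posdef (invmx (s *: invmx (Tbar D g j X))).
Proof.
move=> g0 s0; have Tp := posdef_Tbar j X g0.
rewrite invmxZ ?unitmxZ ?unitfE ?gt_eqF ?unitmx_inv ?posdef_unitmx//.
by rewrite invmxK; apply: posdefZ => //; rewrite invr_gt0.
Qed.

(** Both sides equal [c * K] times the normal probability of [A]: on the right because the posterior
    density has mass one. *)
Lemma mx_int_joint_pdf s (l : coefficients R D) (X : data R q n) k j A :
  0 < g k -> 0 < s j -> measurable A ->
  let joint x :=
    joint_pdf g a s
      (fun k' j' => (dfwith l (k, j) x : coefficients R D) (k', j')) X in
  mx_int (fun x => (joint x * \1_A x)%:E) =
  mx_int (fun x => (joint x)%:E *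
    mvnormal (- Lhat D g j (X k)) (s j *: invmx (Tbar D g j (X k))) A)%E.
Proof.
move=> g0 s0 mA joint; have [c c0 jE] := joint_pdf_dfwith s l X k j.
have [K K0 KE] := mvnormal_pdf_posterior (M := pa_cols (D k) (X k) j)
  (col j (X k)) s0 (posdef_Tbar j (X k) g0).
have nE x : joint x = c * K *
    mvnormal_pdf (- Lhat D g j (X k)) (s j *: invmx (Tbar D g j (X k))) x.
  by rewrite /joint jE -mulrA -KE.
have Sp := posdef_invmx_scale j (X k) g0 s0.
set m := - _ in nE *; set S := _ *: _ in nE Sp *.
have [Q QE] := mvnormal_probability m Sp.
have mpdf : measurable_fun setT (mvnormal_pdf m S).
  exact: measurable_fun_mvnormal_pdf.
(* Homogeneity takes a real factor, so the probability of [A] is first written as a real number. *)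
have rE : (fine (Q A))%:E = mvnormal m S A.
  by rewrite QE// fineK// fin_num_measure.
transitivity ((c * K)%:E * mvnormal m S A)%E.
  rewrite -(tonelliZl (@tonelli_mx_int R _ 1)) ?mulr_ge0//.
  - by congr mx_int; apply/funext => x; rewrite nE -mulrA EFinM.
  - exact: measurable_mvnormal_indic.
  - by move=> x; rewrite lee_fin mulr_ge0// mvnormal_pdf_ge0.
rewrite -rE; transitivity ((c * K * fine (Q A))%:E *
    mx_int (fun x => (mvnormal_pdf m S x)%:E))%E.
  by rewrite mx_int_mvnormal_pdf// mule1 EFinM.
rewrite -(tonelliZl (@tonelli_mx_int R _ 1)) ?mulr_ge0//.
- by congr mx_int; apply/funext => x; rewrite nE -!EFinM mulrAC.
- exact: fine_ge0.
- exact/measurable_EFinP.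
- by move=> x; rewrite lee_fin mvnormal_pdf_ge0.
Qed.

(** This is the measurability clause of [tonelli], with [z] as the parameter. *)
Lemma measurable_mvnormal d (Z : measurableType d) p (m : Z -> 'cV[R]_p) S A :
  measurable_fun setT m -> measurable_fun setT S -> measurable A ->
  measurable_fun setT (fun z => mvnormal (m z) (S z) A).
Proof.
move=> mm mS mA.
have mF : measurable_fun [set: Z * 'cV[R]_p]
    (fun p => (mvnormal_pdf (m p.1) (S p.1) p.2 * \1_A p.2)%:E).
  apply/measurable_EFinP; apply: measurable_funM.
    by apply: measurable_fun_mvnormal_pdf => //; exact: measurableT_comp.
  by apply: measurableT_comp => //; exact: measurable_indic.
have [|mI _ _] := @tonelli_mx_int R p 1 _ _ _ mF; last exact: mI.
by move=> x; rewrite lee_fin mulr_ge0// mvnormal_pdf_ge0.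
Qed.

Lemma measurable_Tbar k j :
  measurable_fun setT (fun X : 'M[R]_(n k, q) => Tbar D g j X).
Proof.
have mpa : measurable_fun setT (fun X : 'M[R]_(n k, q) => pa_cols (D k) X j).
  exact: measurable_fun_mxsub.
apply: measurable_fun_addmx => //.
exact: (measurable_fun_mulmx (measurable_fun_trmx mpa) mpa).
Qed.

Lemma measurable_Lhat k j :
  measurable_fun setT (fun X : 'M[R]_(n k, q) => Lhat D g j X).
Proof.
have mpa : measurable_fun setT (fun X : 'M[R]_(n k, q) => pa_cols (D k) X j).
  exact: measurable_fun_mxsub.
have mcol : measurable_fun setT (fun X : 'M[R]_(n k, q) => col j X).
  exact: measurable_fun_mxsub.
exact: (measurable_fun_mulmx (measurable_fun_mulmx
  (measurable_fun_invmx (@measurable_Tbar k j)) (measurable_fun_trmx mpa))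
  mcol).
Qed.

End posterior.

(** * Disintegration of the joint law *)

Section disintegration.
Variables (R : realType) (q : nat).
Variables (D : 'I_2 -> rel 'I_q) (n : 'I_2 -> nat) (g : 'I_2 -> R) (a : R).

Let coefs_int :=
  iter_int (fun p : 'I_2 * 'I_q => @mx_int R #|pa (D p.1) p.2| 1).
Let data_int := iter_int (fun k : 'I_2 => @mx_int R (n k) q).

(** L_j^(k) is first moved inside the integrals over the other coefficients, then inside those over
    the data. *)
Lemma coefs_int_node (F : coefficients R D * dataset R q n -> \bar R)
    (l0 : coefficients R D)
    (X0 : dataset R q n) k j :
  measurable_fun setT F -> (forall t, 0 <= F t)%E ->
  coefs_int (enum {: 'I_2 * 'I_q})
    (fun l => data_int (enum 'I_2) (fun X => F (l, X)) X0) l0 =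
  coefs_int (rem (k, j) (enum {: 'I_2 * 'I_q}))
    (fun l => data_int (enum 'I_2) (fun X =>
      mx_int (fun x => F (dfwith l (k, j) x, X))) X0) l0.
Proof.
move=> mF F0.
have tX := tonelli_iter_int (T := fun k : 'I_2 =>
  ('M[R]_(n k, q) : measurableType _))
  (int := fun k => @mx_int R (n k) q) (fun p => @tonelli_mx_int R _ _)
  (enum 'I_2) X0.
have [mG G0 _] := tX _ _ _ mF F0.
rewrite [LHS](iter_int_rem (T := fun p : 'I_2 * 'I_q =>
  ('cV[R]_#|pa (D p.1) p.2| : measurableType _)) (i := (k, j))
  (fun p => @tonelli_mx_int R _ _) _
  (fun p p' => commuting_mx_int (@tonelli_mx_int R _ _)) mG G0)//;
  [|exact: enum_uniq|by rewrite mem_enum].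
congr (coefs_int _ _ l0); apply/funext => l.
apply: (commuting_iter_int (T := fun k : 'I_2 =>
  ('M[R]_(n k, q) : measurableType _))
  (int := fun k => @mx_int R (n k) q) (fun p => @tonelli_mx_int R _ _)
  (enum 'I_2) X0 (@tonelli_mx_int R #|pa (D k) j| 1)
  (fun p => commuting_mx_int (@tonelli_mx_int R _ _))
  (F := fun p => F (dfwith l (k, j) p.1, p.2))) => //.
apply: (measurableT_comp mF); apply: measurable_fun_pair => //.
apply: (measurableT_comp (measurable_dfwith (i := (k, j)))
  (g := fun p : 'cV[R]_#|pa (D k) j| * dataset R q n =>
    (l : coefficients R D, p.1))).
by apply: measurable_fun_pair => //; exact: measurable_fst.
Qed.

Context (d : measure_display) (Omega : measurableType d).
Context (P : probability Omega R).
Variables (sigma2 : 'I_q -> {RV P >-> R})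
  (L : forall (k : 'I_2) (j : 'I_q), {RV P >-> 'cV[R]_#|pa (D k) j|})
  (X : forall k : 'I_2, {RV P >-> 'M[R]_(n k, q)}).
Hypothesis g0 : forall k, 0 < g k.
Hypothesis modelP : two_group_model g a sigma2 L X.

(** Unfolding [curry_state] turns the right-hand side into the [state_int] of the model, so the two
    statements are convertible. *)
Lemma state_lawE (E : set (state_type R D n)) : measurable E ->
  P [set w | E (fun j => sigma2 j w, fun k j => L k j w, fun k => X k w)] =
  curried_int (fun t : full R q D n =>
    (joint_pdf g a t.1 (curry_state t).1.2 t.2.2 * \1_E (curry_state t))%:E).
Proof. exact: modelP. Qed.

(* Both cases of the theorem at once: the conditioning variable is a function
   pr of (sigma_j^2, X^(k)), namely the identity or the second projection. *)
Variables (k : 'I_2) (j : 'I_q).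
Context d' (Z : measurableType d') (pr : R * 'M[R]_(n k, q) -> Z).
Variable kap : Z -> set 'cV[R]_#|pa (D k) j| -> \bar R.
Hypothesis mpr : measurable_fun setT pr.
Hypothesis mkap : forall A, measurable A -> measurable_fun setT (kap ^~ A).
Hypothesis kap0 : forall z A, (0 <= kap z A)%E.
(** The kernel is prescribed only at variances that can carry mass; for node 1 this is the value 1
    alone, which allows a kernel that ignores the variance. *)
Hypothesis kapE : forall s x A, 0 < s -> ((j : nat) = 0%N -> s = 1) ->
  kap (pr (s, x)) A = mvnormal (- Lhat D g j x) (s *: invmx (Tbar D g j x)) A.

Let Y w := pr (sigma2 j w, X k w).

Lemma posterior_disintegration A B : measurable A -> measurable B ->
  P (L k j @^-1` A `&` Y @^-1` B) =
  (\int[P]_(w in Y @^-1` B) kap (Y w) A)%E.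
Proof.
move=> mA mB.
pose f (t : full R q D n) := pr (t.1 j, t.2.2 k).
have mf : measurable_fun setT f.
  apply: (measurableT_comp mpr); apply: measurable_fun_pair.
    exact: (measurableT_comp (measurable_proj_pi (i := j)) measurable_fst).
  exact: (measurableT_comp (measurable_proj_pi (i := k))
    (measurableT_comp measurable_snd measurable_snd)).
have ml : measurable_fun setT
    (fun t : full R q D n => t.2.1 (k, j)).
  exact: (measurableT_comp (measurable_proj_pi (i := (k, j)))
    (measurableT_comp measurable_fst measurable_snd)).
pose pdf (t : full R q D n) :=
  joint_pdf g a t.1 (curry_state t).1.2 t.2.2.
have mpdf : measurable_fun setT pdf by exact: measurable_joint_pdf.
have pdf0 t : 0 <= pdf t by exact: joint_pdf_ge0.
have mS : measurable_fun setT
    (fun t : state_type R D n => pr (t.1.1 j, t.2 k)).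
  apply: (measurableT_comp mpr); apply: measurable_fun_pair.
    exact: measurable_state_sigma.
  exact: measurable_state_data.
have mSB C : measurable C ->
    measurable ((fun t : state_type R D n => pr (t.1.1 j, t.2 k)) @^-1` C).
  by move=> mC; rewrite -[X in measurable X]setTI; exact: mS.
(* [F1] and [F2] are the integrands of the two sides; they differ only in that [F2] has the kernel
   in place of the indicator of [A]. *)
pose F1 t := (pdf t * (\1_A (t.2.1 (k, j)) * \1_B (f t)))%:E.
pose h z := (kap z A * (\1_B z)%:E)%E.
pose F2 t := ((pdf t)%:E * h (f t))%E.
have mh : measurable_fun setT h.
  apply: emeasurable_funM; first exact: mkap.
  by apply/measurable_EFinP; exact: measurable_indic.
have h0 z : (0 <= h z)%E by rewrite mule_ge0// lee_fin.
transitivity (curried_int F1).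
  have mE : measurable ((fun t : state_type R D n => t.1.2 k j) @^-1` A `&`
      (fun t : state_type R D n => pr (t.1.1 j, t.2 k)) @^-1` B).
    apply: measurableI; last exact: mSB.
    by rewrite -[X in measurable X]setTI; exact: measurable_state_coef.
  rewrite [LHS](state_lawE mE); congr curried_int; apply/funext => t.
  by rewrite indicI.
transitivity (curried_int F2); last first.
  have mY : measurable_fun setT Y.
    by apply: (measurableT_comp mpr); exact: measurable_fun_pair.
  rewrite integral_mkcond.
  have PY C : measurable C ->
      P (Y @^-1` C) = curried_int (fun t => (pdf t * \1_C (f t))%:E).
    by move=> mC; rewrite [LHS](state_lawE (mSB C mC)).
  rewrite -(integral_density (@tonelli_curried_int R q D n) (mu := P)
    mY mf mpdf pdf0 PY mh h0).
  apply: eq_integral => w _; rewrite patchE /h indicE.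
  have [wB|wB] := pselect (B (Y w)); first by rewrite !mem_set// mule1.
  by rewrite !memNset// mule0.
(* The variances are now fixed; [s1] records that those not integrated, here that of node 1, equal
   1. *)
apply: (eq_iter_int (T := fun _ : 'I_q => measurableTypeR R)) => s s1.
have mF1 : measurable_fun setT F1.
  apply/measurable_EFinP; apply: measurable_funM => //; apply: measurable_funM.
    by apply: measurableT_comp ml; exact: measurable_indic.
  by apply: measurableT_comp mf; exact: measurable_indic.
have mF2 : measurable_fun setT F2.
  apply: emeasurable_funM; first exact/measurable_EFinP.
  exact: (measurableT_comp mh mf).
have F10 t : (0 <= F1 t)%E by rewrite lee_fin mulr_ge0// mulr_ge0.
have F20 t : (0 <= F2 t)%E by rewrite mule_ge0// lee_fin.
have msec F : measurable_fun setT F -> measurable_fun setT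
    (fun p : coefficients R D * dataset R q n => F (s, p) : \bar R).
  move=> mF; apply: (measurableT_comp mF (g := fun p => (s, p))).
  exact: measurable_fun_pair.
rewrite [LHS](coefs_int_node _ _ k j (msec _ mF1) (fun=> F10 _)).
rewrite [RHS](coefs_int_node _ _ k j (msec _ mF2) (fun=> F20 _)).
congr (coefs_int _ _ _); apply/funext => l.
congr (data_int _ _ _); apply/funext => x.
rewrite /F1 /F2 /f /h /=.
set z := pr (s j, x k).
under [in LHS]eq_fun do rewrite dfwithin.
(* [z] does not involve L_j^(k), so the indicator of [B] is constant in the innermost integral. *)
rewrite !indicE; have [zB|zB] := boolP (z \in B); last first.
  by congr mx_int; apply/funext => y; rewrite !mulr0 !mule0.
under [in LHS]eq_fun do rewrite mulr1.
rewrite mule1.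
have sj1 : (j : nat) = 0%N -> s j = 1.
  by move=> j0; rewrite s1// mem_filter /= j0.
(* At a nonpositive variance, impossible for node 1, the joint density vanishes and both sides are
   0. *)
have [sj|sj] := leP (s j) 0.
  have j0 : (j : nat) <> 0%N.
    by move=> j0; move: sj; rewrite sj1// ler10.
  congr mx_int; apply/funext => y.
  by rewrite /pdf (joint_pdf0 _ _ _ _ j0 sj) mul0r mul0e.
rewrite kapE//.
exact: mx_int_joint_pdf.
Qed.

End disintegration.

(** On the event of a nonpositive variance the joint density is 0, by [joint_pdf0]. This makes the
    kernel a probability almost surely. *)
Lemma variance_gt0 (R : realType) (q : nat)
    (D : 'I_2 -> rel 'I_q) (n : 'I_2 -> nat) (g : 'I_2 -> R) (a : R)
    (d : measure_display) (Omega : measurableType d) (P : probability Omega R)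
    (sigma2 : 'I_q -> {RV P >-> R})
    (L : forall (k : 'I_2) (j : 'I_q), {RV P >-> 'cV[R]_#|pa (D k) j|})
    (X : forall k : 'I_2, {RV P >-> 'M[R]_(n k, q)}) (j : 'I_q) :
  two_group_model g a sigma2 L X -> (j : nat) <> 0%N ->
  {ae P, forall w, 0 < sigma2 j w}.
Proof.
move=> modelP j0.
pose E := (fun t : state_type R D n => t.1.1 j) @^-1` `]-oo, 0].
have mE : measurable E.
  by rewrite -[X in measurable X]setTI; exact: measurable_state_sigma.
have PE : P [set w | sigma2 j w <= 0] = 0%E.
  have -> : [set w | sigma2 j w <= 0] =
      [set w | E (fun j => sigma2 j w, fun k j => L k j w, fun k => X k w)].
    by apply/seteqP; split=> w; rewrite /E /= in_itv.
  rewrite [LHS](state_lawE modelP mE).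
  rewrite -[RHS](tonelli0 (@tonelli_curried_int R q D n)).
  congr curried_int; apply/funext => t; rewrite indicE.
  have [|_] := boolP (_ \in E); last by rewrite mulr0.
  rewrite inE /E /= in_itv /= => tj.
  by rewrite (joint_pdf0 _ _ _ _ j0 tj) mul0r.
exists [set w | sigma2 j w <= 0]; split => //.
  rewrite (_ : [set w | _] = sigma2 j @^-1` `]-oo, 0]).
    by rewrite -[X in measurable X]setTI; exact: measurable_funPT.
  by apply/seteqP; split=> w /=; rewrite in_itv.
by move=> w /= /negP; rewrite -leNgt.
Qed.

Theorem mainTheorem3 (R : realType) (q : nat)
    (D : 'I_2 -> rel 'I_q) (n : 'I_2 -> nat) (g : 'I_2 -> R) (a : R)
    (d : measure_display) (Omega : measurableType d) (P : probability Omega R)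
    (sigma2 : 'I_q -> {RV P >-> R})
    (L : forall (k : 'I_2) (j : 'I_q), {RV P >-> 'cV[R]_#|pa (D k) j|})
    (X : forall k : 'I_2, {RV P >-> 'M[R]_(n k, q)}) :
  (0 < q)%N ->
  (forall k, is_dag (D k)) ->
  (forall k, 0 < g k) ->
  q%:R - 1 < a ->
  two_group_model g a sigma2 L X ->
  forall (k : 'I_2) (j : 'I_q),
    ((j : nat) <> 0%N ->
      conditional_distribution P (L k j) (fun w => (sigma2 j w, X k w))
        (fun z : R * 'M[R]_(n k, q) =>
           mvnormal (- Lhat D g j z.2) (z.1 *: invmx (Tbar D g j z.2))))
    /\
    ((j : nat) = 0%N ->
      conditional_distribution P (L k j) (X k)
        (fun x : 'M[R]_(n k, q) =>
           mvnormal (- Lhat D g j x) (invmx (Tbar D g j x)))).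
Proof.
move=> _ _ g0 _ modelP k j.
have mvn0 p (m : 'cV[R]_p) S A : (0 <= mvnormal m S A)%E.
  by apply: mx_int_ge0 => x; rewrite lee_fin mulr_ge0// mvnormal_pdf_ge0.
have mL := @measurable_Lhat R q D n g k j.
have mT := measurable_fun_invmx (@measurable_Tbar R q D n g k j).
split=> j0; split.
- move=> A mA; apply: measurable_mvnormal => //.
    apply: measurable_fun_oppmx.
    exact: (measurableT_comp mL measurable_snd).
  apply: measurable_fun_scalemx; first exact: measurable_fst.
  exact: (measurableT_comp mT measurable_snd).
- apply: filterS (variance_gt0 modelP j0) => w sj.
  have [Q QE] := mvnormal_probability (- Lhat D g j (X k w))
    (posdef_invmx_scale D j (X k w) (g0 k) sj).
  by exists Q.
- move=> A B mA mB.
  apply: (posterior_disintegration g0 modelP (pr := id)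
    (kap := fun z : R * 'M[R]_(n k, q) =>
       mvnormal (- Lhat D g j z.2) (z.1 *: invmx (Tbar D g j z.2)))) => //.
  move=> A' mA'; apply: measurable_mvnormal => //.
    apply: measurable_fun_oppmx.
    exact: (measurableT_comp mL measurable_snd).
  apply: measurable_fun_scalemx; first exact: measurable_fst.
  exact: (measurableT_comp mT measurable_snd).
- move=> A mA; apply: measurable_mvnormal => //.
  exact: measurable_fun_oppmx.
(* With variance 1 the covariance is the inverse of a positive definite matrix for every outcome, so
   no null set is excluded. *)
- apply: nearW => w.
  have Sp : posdef (invmx (invmx (Tbar D g j (X k w)))).
    by rewrite invmxK; exact: posdef_Tbar.
  have [Q QE] := mvnormal_probability (- Lhat D g j (X k w)) Sp.
  by exists Q.
- move=> A B mA mB.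
  apply: (posterior_disintegration g0 modelP (pr := snd)
    (kap := fun x => mvnormal (- Lhat D g j x) (invmx (Tbar D g j x)))) => //.
    move=> A' mA'; apply: measurable_mvnormal => //.
    exact: measurable_fun_oppmx.
  (* For node 1 the variance is 1, and the scaling of the covariance disappears. *)
  by move=> s x A' s0 ->//; rewrite scale1r.
Qed.
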